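(* The smooth manifold $S^1\times S^7\times S^6$ is a complex manifold, i.e. it admits an integrable almost complex structure.
   Context: $S^1\times S^7\times S^6$ carries the product of the standard smooth structures of the spheres. An almost complex structure $J$ on a smooth manifold $M$ is a smooth endomorphism of $TM$ with $J^2=-I$; it is integrable if it is induced from a complex structure (holomorphic atlas compatible with the smooth structure) on $M$. *)

(* Defs.v *)
From HB Require Import structures.
From mathcomp Require Import all_boot all_order all_algebra.
From mathcomp Require Import all_classical all_reals all_analysis.
From mathcomp Require Import complex.

Set Implicit Arguments.
Unset Strict Implicit.
Unset Printing Implicit Defensive.

Import Order.TTheory GRing.Theory Num.Theory.
Import numFieldNormedType.Exports.

Local Open Scope classical_set_scope.
Local Open Scope ring_scope.
Local Open Scope complex_scope.

(* Manifolds are smooth submanifolds M of a finite-dimensional real normed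
   space V, given as sets.  The spheres carry the smooth structure induced
   from R^n.+1, and a product of submanifolds M of V and N of W is the
   submanifold M `*` N of V * W; its submanifold structure is the product
   structure. *)

(* The norm of the library on 'rV[R]_n is the sup norm, so the Euclidean one
   is written out. *)
Definition sphere (R : realType) (n : nat) : set 'rV[R]_n.+1 :=
  [set x : 'rV[R]_n.+1 | \sum_i x 0 i ^+ 2 = 1].

Arguments sphere R n : clear implicits.

Section Smoothness.
Variables (R : realType) (V W : normedModType R).

(* Used for open U and finite-dimensional V, where 'd f x is the Frechet
   derivative and continuity of all x |-> 'd f x v is continuity of the
   derivative. *)
Fixpoint Ck_on (k : nat) (U : set V) (f : V -> W) : Prop :=
  if k is k'.+1 then
    (forall x, U x -> differentiable f x) /\
    (forall v, Ck_on k' U (fun x => 'd f x v))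
  else forall x, U x -> {for x, continuous f}.

(* Smoothness of a map defined on an arbitrary subset A of V: locally, it is
   the restriction of a C^oo map defined on an open set.  For open A this is
   C^oo on A; for a submanifold A it is smoothness for the induced structure.
   The values of f outside A are irrelevant. *)
Definition smooth_on (A : set V) (f : V -> W) : Prop :=
  forall x, A x -> exists (U : set V) (F : V -> W),
    [/\ open U, U x, (forall k, Ck_on k U F) &
        forall y, A y -> U y -> f y = F y].

End Smoothness.

Section TangentBundle.
Variables (R : realType) (V : normedModType R).

Definition tangent_space (M : set V) (p : V) : set V :=
  [set v | exists (g : R -> V) (I : set R),
    [/\ open I, I 0, smooth_on I g, (forall t, I t -> M (g t)) &
        g 0 = p /\ is_derive (0 : R) 1 g v]].

Definition tangent_bundle (M : set V) : set (V * V) :=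
  [set pv | M pv.1 /\ tangent_space M pv.1 pv.2].

(* J p v is the value at v of the endomorphism of the tangent space at p; it
   is meaningful only for (p, v) in the tangent bundle. *)
Definition almost_complex_structure (M : set V) (J : V -> V -> V) : Prop :=
  [/\ forall p v, M p -> tangent_space M p v -> tangent_space M p (J p v),
      forall p (a : R) v w, M p -> tangent_space M p v ->
        tangent_space M p w -> J p (a *: v + w) = a *: J p v + J p w,
      smooth_on (tangent_bundle M) (fun pv => J pv.1 pv.2) &
      forall p v, M p -> tangent_space M p v -> J p (J p v) = - v].

End TangentBundle.

(* The library's normed-space structures on a numClosedFieldType are found only
   when the carrier is presented as one. *)
Definition Cplx (R : realType) : numClosedFieldType := R[i].

(* Cplx R ^ m is a normed space over Cplx R only; its underlying real normed space is
   R^m * R^m, through z = x + iy |-> (x, y). *)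
Definition realify (R : realType) (m : nat) (z : 'rV[Cplx R]_m) :
    'rV[R]_m * 'rV[R]_m :=
  (map_mx (fun a : Cplx R => complex.Re a) z,
   map_mx (fun a : Cplx R => complex.Im a) z).

Definition complexify (R : realType) (m : nat) (u : 'rV[R]_m * 'rV[R]_m) :
    'rV[Cplx R]_m :=
  map2_mx (fun x y : R => (x +i* y : Cplx R)) u.1 u.2.

Lemma realifyK (R : realType) m : cancel (@realify R m) (@complexify R m).
Proof. by move=> z; apply/matrixP => i j; rewrite !mxE; case: (z i j). Qed.

Lemma complexifyK (R : realType) m : cancel (@complexify R m) (@realify R m).
Proof.
by move=> [x y]; congr pair; apply/matrixP => i j; rewrite !mxE.
Qed.

Section ComplexStructures.
Variables (R : realType) (V : normedModType R) (m : nat).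

(* chart_inv is meaningful only on the image of chart_map. *)
Record complex_chart := ComplexChart {
  chart_dom : set V;
  chart_map : V -> 'rV[Cplx R]_m;
  chart_inv : 'rV[Cplx R]_m -> V }.

Implicit Types c : complex_chart.

Definition chart_image c : set 'rV[Cplx R]_m := chart_map c @` chart_dom c.

(* c is a diffeomorphism from an open subset of M onto an open subset of C^m. *)
Definition smooth_chart (M : set V) c : Prop :=
  [/\ exists O : set V, open O /\ chart_dom c = M `&` O,
      open (chart_image c),
      forall p, chart_dom c p -> chart_inv c (chart_map c p) = p,
      smooth_on (chart_dom c) (@realify R m \o chart_map c) &
      smooth_on (@realify R m @` chart_image c)
        (chart_inv c \o @complexify R m)].

(* Differentiability here is over the field Cplx R. *)
Definition holomorphic_transition c d : Prop :=
  forall w, (chart_map c @` (chart_dom c `&` chart_dom d)) w ->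
    differentiable (chart_map d \o chart_inv c) w.

Definition complex_structure (M : set V) (A : set complex_chart) : Prop :=
  [/\ forall c, A c -> smooth_chart M c,
      \bigcup_(c in A) chart_dom c = M &
      forall c d, A c -> A d -> holomorphic_transition c d].

(* J corresponds to multiplication by i in the chart c. *)
Definition induced_by_chart (J : V -> V -> V) c : Prop :=
  forall (w xi : 'rV[Cplx R]_m), chart_image c w ->
    let dpsi := 'd (chart_inv c \o @complexify R m) (realify w) in
    J (chart_inv c w) (dpsi (realify xi)) = dpsi (realify ((0 +i* 1 : Cplx R) *: xi)).

Definition integrable_structure (M : set V) (J : V -> V -> V) : Prop :=
  exists2 A : set complex_chart, complex_structure M A &
    forall c, A c -> induced_by_chart J c.

End ComplexStructures.

(* Main.v *)
(* The cone C = { z in C^8 \ {0} : sum_i z_i^2 = 0 } is a complex manifold of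
   dimension 7.  Writing z = e^t (u + i v) with t real, u and v become orthonormal
   vectors of R^8, and because S^7 is parallelizable by octonion multiplication,
   v = u w for a unique w in the unit sphere S^6 of the imaginary octonions.  The
   quotient of C by the homothety of ratio e^(2 pi) is thus S^1 x S^7 x S^6, the
   circle being (cos t, sin t).  Holomorphic charts of the cone, composed with
   local determinations of t, are the charts of the product; the induced almost
   complex structure is polynomial in the coordinates of R^2 x R^8 x R^7. *)
From HB Require Import structures.
Require Import Defs.
From mathcomp Require Import all_boot all_order all_algebra.
From mathcomp Require Import all_classical all_reals all_analysis.
From mathcomp Require Import complex ring lra.

Set Implicit Arguments.
Unset Strict Implicit.
Unset Printing Implicit Defensive.

Import Order.TTheory GRing.Theory Num.Theory.
Import numFieldNormedType.Exports.

Local Open Scope classical_set_scope.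
Local Open Scope ring_scope.

(** * Smooth calculus *)

(** No transition map is ever differentiated over the complex numbers by hand. One global [octJ] is
    shown to be multiplication by i in every chart; hence the real derivative of a transition map
    commutes with i, and the Cauchy-Riemann criterion turns real into complex differentiability.
    What shapes the rest is that smoothness of a map on a subset asks for extensions to open sets of
    the ambient space, so both directions of every chart are given by closed formulas that make
    sense off the manifold, with no appeal to an inverse function theorem. On the cone this rests on
    the factorisation z_0^2 + z_(k+1)^2 = a b with a = z_0 + i eps z_(k+1) and b = z_0 - i eps
    z_(k+1): the equation becomes linear in b and is solved by one division. On the side of the
    spheres it rests on a matrix identity: w is obtained from u and v by a transposed matrix,
    bilinearly, so no inverse of u is needed. *)

Section DifferentialEps.
Variables (K : numFieldType) (V W : normedModType K).
Implicit Types (f g : V -> W) (x : V).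

(** Uniqueness of the first-order expansion identifies the derivative. The field is arbitrary
    because the criterion serves over [R] and, for the transition maps, over [Cplx R]. *)
Lemma differentiable_epsP f x (L : {linear V -> W}) : continuous L ->
  (forall e : K, 0 < e ->
     \forall h \near (0 : V), `|f (h + x) - f x - L h| <= e * `|h|) ->
  differentiable f x /\ 'd f x = L :> (V -> W).
Proof.
move=> Lc fL.
have E : f \o shift x = cst (f x) + (L : V -> W) +o_ 0 id.
  apply/eqaddoP => e e0; apply: filterS (fL e e0) => h /=.
  by rewrite -[(f \o shift x - _) h]/(f (h + x) - (f x + L h)) opprD addrA.
have dE : 'd f x = L :> (V -> W) by exact: diff_unique.
by split=> //; apply/diff_locallyP; rewrite dE; split.
Qed.

Lemma diff_eps f x : differentiable f x ->
  forall e : K, 0 < e ->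
    \forall h \near (0 : V), `|f (h + x) - f x - 'd f x h| <= e * `|h|.
Proof.
move=> /diff_locallyP[_ /eqaddoP fE] e e0.
apply: filterS (fE e e0) => h /=.
by rewrite -[(f \o shift x - _) h]/(f (h + x) - (f x + 'd f x h)) opprD addrA.
Qed.

Lemma near0_shift x (P : set V) :
  (\forall y \near x, P y) -> \forall h \near (0 : V), P (h + x).
Proof. by rewrite (near_shift 0) subr0. Qed.

Lemma near_eq_diff f g x : (\forall y \near x, f y = g y) ->
  differentiable f x -> differentiable g x /\ 'd g x = 'd f x :> (V -> W).
Proof.
move=> fg df; apply: differentiable_epsP.
  exact: diff_continuous.
move=> e e0; apply: filterS2 (near0_shift fg) (diff_eps df e0) => h <-.
by rewrite (nbhs_singleton fg).
Qed.

Lemma near_eq_diffE f g x v : (\forall y \near x, f y = g y) ->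
  differentiable f x -> 'd g x v = 'd f x v.
Proof.
by move=> fg df; exact: (f_equal (fun h : V -> W => h v) (near_eq_diff fg df).2).
Qed.

End DifferentialEps.

Lemma diff_compE (K : numFieldType) (U V W : normedModType K) (f : U -> V)
    (g : V -> W) x v : differentiable f x -> differentiable g (f x) ->
  'd (g \o f) x v = 'd g (f x) ('d f x v).
Proof.
by move=> df dg; exact: (f_equal (fun h : U -> W => h v) (diff_comp df dg)).
Qed.

Lemma diff_cstE (K : numFieldType) (V W : normedModType K) (a : W) (x v : V) :
  'd (fun=> a) x v = 0.
Proof. exact: (f_equal (fun h : V -> W => h v) (diff_cst _ _)). Qed.

Lemma diff_idE (K : numFieldType) (V : normedModType K) (x v : V) :
  'd id x v = v.
Proof.
have idc : continuous (@idfun V) by move=> y; exact.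
exact: (f_equal (fun h : V -> V => h v) (@diff_lin _ _ _ (@idfun V) x idc)).
Qed.

Section SmoothCalculus.
Variable R : realType.

Definition smooth (V W : normedModType R) (U : set V) (f : V -> W) : Prop :=
  forall k, Ck_on k U f.

Section Generic.
Variables V W : normedModType R.
Implicit Types (U A : set V) (f g : V -> W).

(** Openness of [U] makes pointwise equality an equality near each point, so the derivatives agree
    too and the induction goes on. It lets a derivative be replaced by its formula when the formula
    is valid on [U] only. *)
Lemma Ck_on_eq k U f g : open U -> (forall x, U x -> f x = g x) ->
  Ck_on k U f -> Ck_on k U g.
Proof.
move=> oU; elim: k f g => [|k IH] f g fg /= Cf.
  move=> x Ux; have fc : f @ x --> f x := Cf x Ux.
  rewrite /prop_for /continuous_at -(fg x Ux).
  apply: cvg_trans fc; apply: near_eq_cvg.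
  by apply: filterS (open_nbhs_nbhs (conj oU Ux)) => y /fg.
case: Cf => df Cf.
have D x : U x -> differentiable g x /\ 'd g x = 'd f x :> (V -> W).
  move=> Ux; apply: near_eq_diff (df x Ux).
  by apply: filterS (open_nbhs_nbhs (conj oU Ux)) => y /fg.
split=> [x /D[]//|v]; apply: (IH (fun x => 'd f x v)) (Cf v) => x Ux.
exact: (f_equal (fun h : V -> W => h v) (esym (D x Ux).2)).
Qed.

Lemma Ck_onW k U f : Ck_on k.+1 U f -> Ck_on k U f.
Proof.
elim: k f => [|k IH] f [df Cf]; first by move=> x /df /differentiable_continuous.
by split=> // v; exact: IH (Cf v).
Qed.

Lemma Ck_on_continuous k U f : Ck_on k U f ->
  forall x, U x -> {for x, continuous f}.
Proof. by case: k => // k [df _] x /df /differentiable_continuous. Qed.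

Lemma Ck_on_sub k U A f : A `<=` U -> Ck_on k U f -> Ck_on k A f.
Proof.
move=> AU; elim: k f => [|k IH] f /=; first by move=> Cf x /AU /Cf.
by move=> [df Cf]; split=> [x /AU /df//|v]; exact: IH.
Qed.

Lemma Ck_on_cst k U (a : W) : Ck_on k U (cst a).
Proof.
elim: k a => [|k IH] a /=; first by move=> x _; exact: cst_continuous.
split=> [x _|v]; first exact: differentiable_cst.
rewrite [X in Ck_on _ _ X](_ : _ = cst 0) ?funeqE// => x.
by rewrite diff_cst.
Qed.

Lemma Ck_on_linear k U (f : {linear V -> W}) : continuous f -> Ck_on k U f.
Proof.
case: k => [|k] fc /=; first by move=> x _; exact: fc.
split=> [x _|v]; first exact: linear_differentiable.
rewrite [X in Ck_on _ _ X](_ : _ = cst (f v)) ?funeqE; first exact: Ck_on_cst.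
by move=> x; rewrite diff_lin.
Qed.

Lemma diffDE f g x v : differentiable f x -> differentiable g x ->
  'd (fun y => f y + g y) x v = 'd f x v + 'd g x v.
Proof. by move=> df dg; exact: (f_equal (fun h : V -> W => h v) (diffD df dg)). Qed.

Lemma diffNE f x v : differentiable f x -> 'd (fun y => - f y) x v = - 'd f x v.
Proof. by move=> df; exact: (f_equal (fun h : V -> W => h v) (diffN df)). Qed.

Lemma diffBE f g x v : differentiable f x -> differentiable g x ->
  'd (fun y => f y - g y) x v = 'd f x v - 'd g x v.
Proof.
move=> df dg; apply: (etrans (diffDE v df (differentiableN dg))).
by congr (_ + _); exact: diffNE.
Qed.

Lemma Ck_onD k U f g : open U -> Ck_on k U f -> Ck_on k U g ->
  Ck_on k U (fun x => f x + g x).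
Proof.
move=> oU; elim: k f g => [|k IH] f g /= Cf Cg.
  by move=> x Ux; apply: continuousD; [exact: Cf|exact: Cg].
case: Cf Cg => df Cf [dg Cg]; split=> [x Ux|v].
  exact: differentiableD (df _ Ux) (dg _ Ux).
apply: (Ck_on_eq oU _ (IH _ _ (Cf v) (Cg v))) => x Ux.
by rewrite diffDE//; [exact: df|exact: dg].
Qed.

Lemma smooth_sub U A f : A `<=` U -> smooth U f -> smooth A f.
Proof. by move=> AU sf k; exact: Ck_on_sub (sf k). Qed.

Lemma smooth_eq U f g : open U -> (forall x, U x -> f x = g x) ->
  smooth U f -> smooth U g.
Proof. by move=> oU fg sf k; exact: Ck_on_eq (sf k). Qed.

Lemma smooth_cst U (a : W) : smooth U (fun=> a).
Proof. by move=> k; exact: Ck_on_cst. Qed.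

Lemma smooth_linear U (f : {linear V -> W}) : continuous f -> smooth U f.
Proof. by move=> fc k; exact: Ck_on_linear. Qed.

Lemma smoothD U f g : open U -> smooth U f -> smooth U g ->
  smooth U (fun x => f x + g x).
Proof. by move=> oU sf sg k; exact: Ck_onD. Qed.

Lemma smooth_differentiable U f x : smooth U f -> U x -> differentiable f x.
Proof. by move=> sf; case: (sf 1%N) => + _; exact. Qed.

Lemma smooth_sum U n (f : 'I_n -> V -> W) : open U ->
  (forall i, smooth U (f i)) -> smooth U (fun x => \sum_i f i x).
Proof.
move=> oU; elim: n f => [|n IH] f sf.
  by apply: (smooth_eq oU _ (smooth_cst U 0)) => x _; rewrite big_ord0.
have sS : smooth U (fun x => f ord0 x + \sum_(i < n) f (lift ord0 i) x).
  by apply: smoothD => //; apply: IH.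
by apply: (smooth_eq oU _ sS) => x _; rewrite big_ord_recl.
Qed.

End Generic.

Section Scalar.
Variable V : normedModType R.
Implicit Types (U : set V) (f g : V -> R).

Lemma diffZlE (W : normedModType R) f (w : W) x v : differentiable f x ->
  'd (fun y => f y *: w) x v = 'd f x v *: w.
Proof. by move=> df; exact: (f_equal (fun h : V -> W => h v) (diffZl w df)). Qed.

Lemma diffME f g x v : differentiable f x -> differentiable g x ->
  'd (fun y => f y * g y) x v = f x * 'd g x v + g x * 'd f x v.
Proof. by move=> df dg; exact: (f_equal (fun h : V -> R => h v) (diffM df dg)). Qed.

Lemma Ck_onZl (W : normedModType R) k U f (w : W) : open U -> Ck_on k U f ->
  Ck_on k U (fun x => f x *: w).
Proof.
move=> oU; elim: k f => [|k IH] f /= Cf.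
  by move=> x Ux; apply: cvgZr_tmp; exact: Cf.
case: Cf => df Cf; split=> [x Ux|v]; first exact: differentiableZl (df _ Ux).
by apply: (Ck_on_eq oU _ (IH _ (Cf v))) => x Ux; rewrite (diffZl _ (df _ Ux)).
Qed.

(** The product rule brings back [f] and [g] themselves next to their derivatives, hence the use of
    [Ck_onW] to lower their order by one. *)
Lemma Ck_onM k U f g : open U -> Ck_on k U f -> Ck_on k U g ->
  Ck_on k U (fun x => f x * g x).
Proof.
move=> oU; elim: k f g => [|k IH] f g Cf Cg.
  by move=> x Ux; apply: cvgM; [exact: Cf|exact: Cg].
have [Cf' Cg'] := (Ck_onW Cf, Ck_onW Cg).
case: Cf Cg => df Cf [dg Cg]; split=> [x Ux|v].
  exact: differentiableM (df _ Ux) (dg _ Ux).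
apply: (Ck_on_eq oU _ (Ck_onD oU (IH _ _ Cf' (Cg v)) (IH _ _ Cg' (Cf v)))).
by move=> x Ux; rewrite diffME; [|exact: df|exact: dg].
Qed.

Lemma diff_comp1 (h : R -> R) f x v :
  differentiable f x -> differentiable h (f x) ->
  'd (h \o f) x v = 'd f x v * 'd h (f x) 1.
Proof.
move=> df dh; rewrite (diff_comp df dh) /=.
by rewrite -[in LHS](mulr1 ('d f x v)) -[_ * 1]/(_ *: 1) linearZ.
Qed.

(** With an outer function of one real variable the chain rule is a product of scalar functions, so
    closure under products suffices for the induction. *)
Lemma Ck_on_comp k (D : set R) (h : R -> R) U f : open U ->
  (forall x, U x -> D (f x)) -> Ck_on k D h -> Ck_on k U f ->
  Ck_on k U (fun x => h (f x)).
Proof.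
move=> oU fD; elim: k h => [|k IH] h Ch Cf.
  by move=> x Ux; apply: (@continuous_comp _ _ _ f h); [exact: Cf|exact/Ch/fD].
have Cf' := Ck_onW Cf.
case: Cf Ch => df Cf [dh Ch]; split=> [x Ux|v].
  exact: differentiable_comp (df _ Ux) (dh _ (fD _ Ux)).
apply: (Ck_on_eq oU _ (Ck_onM oU (Cf v) (IH _ (Ch 1) Cf'))) => x Ux.
by rewrite -diff_comp1 //; [exact: df|exact/dh/fD].
Qed.

Lemma smoothZl (W : normedModType R) U f (w : W) : open U -> smooth U f ->
  smooth U (fun x => f x *: w).
Proof. by move=> oU sf k; exact: Ck_onZl. Qed.

Lemma smoothM U f g : open U -> smooth U f -> smooth U g ->
  smooth U (fun x => f x * g x).
Proof. by move=> oU sf sg k; exact: Ck_onM. Qed.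

Lemma smooth_comp (D : set R) (h : R -> R) U f : open U ->
  smooth D h -> (forall x, U x -> D (f x)) -> smooth U f ->
  smooth U (fun x => h (f x)).
Proof. by move=> oU sh fD sf k; exact: Ck_on_comp fD (sh k) (sf k). Qed.

Lemma smoothN U f : open U -> smooth U f -> smooth U (fun x => - f x).
Proof.
move=> oU sf; have sN : smooth U (fun x => -1 * f x).
  exact: smoothM (smooth_cst U (-1 : R)) sf.
apply: (smooth_eq oU _ sN).
by move=> x _; rewrite mulN1r.
Qed.

Lemma smoothB U f g : open U -> smooth U f -> smooth U g ->
  smooth U (fun x => f x - g x).
Proof. by move=> oU sf sg; apply: smoothD => //; exact: smoothN. Qed.

End Scalar.

(** * Elementary functions of one real variable *)

Section Univariate.
Implicit Types (D : set R) (h : R -> R).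

Lemma is_derive_differentiable h x d : is_derive x (1 : R) h d ->
  differentiable h x /\ forall v, 'd h x v = v * d.
Proof.
move=> [dh hd]; have dh' := dh; move/derivable1_diffP: dh' => dh'.
by split=> // v; rewrite deriv1E// derive1E hd.
Qed.

Lemma Ck_on_derive k D h (d : R -> R) : open D ->
  (forall x, D x -> is_derive x (1 : R) h (d x)) -> Ck_on k D d ->
  Ck_on k.+1 D h.
Proof.
move=> oD hd Cd; split=> [x /hd /is_derive_differentiable[]//|v].
apply: (Ck_on_eq oD _ (Ck_onM oD (Ck_on_cst k D v) Cd)) => x Dx.
by have [_ ->] := is_derive_differentiable (hd x Dx).
Qed.

Lemma smooth_derive D h (d : R -> R) : open D ->
  (forall x, D x -> is_derive x (1 : R) h (d x)) -> smooth D d -> smooth D h.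
Proof. by move=> oD hd sd k; apply: Ck_onW; exact: Ck_on_derive. Qed.

Lemma smooth_expR D : open D -> smooth D (@expR R).
Proof.
move=> oD; elim=> [|k IH]; first by move=> x _; exact: continuous_expR.
by apply: Ck_on_derive IH.
Qed.

Lemma smooth_sin_cos D : open D -> smooth D (@sin R) /\ smooth D (@cos R).
Proof.
move=> oD; suff H k : Ck_on k D (@sin R) /\ Ck_on k D (@cos R).
  by split=> k; case: (H k).
elim: k => [|k [IHs IHc]].
  by split=> x _; [exact: continuous_sin|exact: continuous_cos].
split; first by apply: Ck_on_derive IHc.
apply: (@Ck_on_derive _ _ _ (fun x => -1 * sin x)) => //.
  by move=> x _; rewrite mulN1r; exact: is_derive_cos.
exact: (Ck_onM oD (Ck_on_cst k D (-1 : R)) IHs).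
Qed.

(** A bootstrap: the derivative is a polynomial in the function itself, so class k of the inverse
    yields class k + 1. *)
Lemma smooth_inv : smooth [set x : R | x != 0] (@GRing.inv R).
Proof.
have o0 : open [set x : R | x != 0] by exact: open_neq.
elim=> [|k IH]; first by move=> x x0; exact: inv_continuous.
apply: (@Ck_on_derive _ _ _ (fun x => -1 * (x^-1 * x^-1))) => //.
  move=> x x0; have := @is_deriveV _ id x 1 1 x0 (is_derive_id _ _).
  by move=> /is_derive_eq; apply; rewrite -[LHS]/(- x ^- 2 * 1) mulr1 mulN1r expr2 invfM.
exact: (Ck_onM o0 (Ck_on_cst k _ (-1 : R)) (Ck_onM o0 IH IH)).
Qed.

Lemma smooth_ln : smooth [set x : R | 0 < x] (@ln R).
Proof.
have o0 : open [set x : R | 0 < x] by exact: open_gt.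
apply: (smooth_derive o0 (fun x (x0 : 0 < x) => is_derive1_ln x0)).
have sub : [set x : R | 0 < x] `<=` [set x | x != 0].
  by move=> x; exact: lt0r_neq0.
exact: smooth_sub sub smooth_inv.
Qed.

Lemma smooth_atan : smooth setT (@atan R).
Proof.
apply: (smooth_derive openT (fun x _ => is_derive1_atan x)).
have sid : smooth setT (@idfun R) by apply: smooth_linear => x; exact.
apply: (smooth_comp openT smooth_inv).
  by move=> x _ /=; rewrite lt0r_neq0// ltr_wpDr// sqr_ge0.
apply: smoothD; [exact: openT|exact: smooth_cst|].
exact: (smoothM openT sid sid).
Qed.

End Univariate.

End SmoothCalculus.

(** * Real and complex derivatives *)

Section MatrixNorm.
Variables (K : numFieldType) (m n : nat).
Implicit Type x : 'M[K]_(m, n).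

Lemma normr_mx_entry x i j : `|x i j| <= `|x|.
Proof.
rewrite [leRHS]/Num.norm /= mx_normE -[leLHS]nngE num_le.
exact: (@le_bigmax _ _ _ _ (fun i => `|x i.1 i.2|%:nng) (i, j)).
Qed.

Lemma normr_mx_le x (e : K) : 0 <= e -> (forall i j, `|x i j| <= e) -> `|x| <= e.
Proof.
move=> e0 xe; have [->|/mx_norm_neq0[ij]] := eqVneq (`|x|) 0; first by [].
by rewrite -[mx_norm x]/(`|x|) => ->.
Qed.

End MatrixNorm.

Section RealComplex.
Variable R : realType.
Local Notation C := (Cplx R).
Local Open Scope complex_scope.

Section Dim.
Variable m : nat.
Implicit Types (z : 'rV[C]_m) (u : 'rV[R]_m * 'rV[R]_m).

(** Multiplication by i, read on pairs of real and imaginary parts. *)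
Definition realify_i u : 'rV[R]_m * 'rV[R]_m := (- u.2, u.1).

Lemma realifyD z z' : realify (z + z') = realify z + realify z'.
Proof.
by congr pair; apply/rowP => j; rewrite !mxE; case: (z _ _) (z' _ _) => [a b] [c d].
Qed.

Lemma realifyN z : realify (- z) = - realify z.
Proof. by congr pair; apply/rowP => j; rewrite !mxE; case: (z _ _). Qed.

Lemma realify0 : realify (0 : 'rV[C]_m) = 0.
Proof. by congr pair; apply/rowP => j; rewrite !mxE. Qed.

Lemma realifyZi z : realify ((0 +i* 1 : C) *: z) = realify_i (realify z).
Proof.
by congr pair; apply/rowP => j; rewrite !mxE; case: (z _ _) => a b /=; ring.
Qed.

Lemma realifyZ (a : C) z :
  realify (a *: z) = complex.Re a *: realify z +
                     complex.Im a *: realify_i (realify z).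
Proof.
case: a => a b; congr pair; apply/rowP => j; rewrite !mxE;
  by case: (z _ _) => c d /=; ring.
Qed.

Lemma normr_real_complex (a : C) : `|complex.Re a|%:C <= `|a| :> C.
Proof.
case: a => a b; rewrite normc_def lecR /= -sqrtr_sqr.
by rewrite ler_wsqrtr// lerDl sqr_ge0.
Qed.

Lemma normr_imag_complex (a : C) : `|complex.Im a|%:C <= `|a| :> C.
Proof.
case: a => a b; rewrite normc_def lecR /= -sqrtr_sqr.
by rewrite ler_wsqrtr// lerDr sqr_ge0.
Qed.

Lemma ge0_complexE (a : C) : 0 <= a -> a = (complex.Re a)%:C.
Proof. by move=> /ger0_real /RRe_real. Qed.

Lemma normr_realify z : (`|realify z|%:C : C) <= `|z|.
Proof.
rewrite (ge0_complexE (normr_ge0 z)) lecR prod_normE ge_max.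
have z0 : 0 <= complex.Re (`|z| : C).
  by rewrite -ler0c -ge0_complexE// normr_ge0.
have H (a : C) b : a <= `|z| -> b%:C <= a -> b <= complex.Re (`|z| : C).
  by move=> az ba; rewrite -lecR -ge0_complexE ?normr_ge0//; exact: le_trans az.
by apply/andP; split; apply: normr_mx_le => // i j; rewrite !mxE;
  apply: H (normr_mx_entry z i j) _;
  [exact: normr_real_complex|exact: normr_imag_complex].
Qed.

Lemma normr_complexify u : `|complexify u| <= ((2 * `|u|)%:C : C).
Proof.
have u0 := normr_ge0 u.
apply: normr_mx_le => [|i j]; first by rewrite ler0c mulr_ge0.
have [H1 H2] : `|u.1 i j| <= `|u| /\ `|u.2 i j| <= `|u|.
  by rewrite prod_normE !le_max !normr_mx_entry ?orbT.
rewrite mxE normc_def lecR /= -[leRHS]ger0_norm ?mulr_ge0// -sqrtr_sqr.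
rewrite ler_wsqrtr// -(real_normK (num_real (u.1 i j))) -(real_normK (num_real (u.2 i j))).
move: H1 H2 (normr_ge0 (u.1 i j)) (normr_ge0 (u.2 i j)); nra.
Qed.

Lemma complexifyD u v : complexify (u + v) = complexify u + complexify v :> 'rV[C]_m.
Proof. by apply: (can_inj (@realifyK R m)); rewrite realifyD !complexifyK. Qed.

Lemma complexifyN u : complexify (- u) = - complexify u :> 'rV[C]_m.
Proof. by apply: (can_inj (@realifyK R m)); rewrite realifyN !complexifyK. Qed.

Lemma realify_continuous : continuous (@realify R m).
Proof.
move=> z; have Fz : Filter (nbhs z) := nbhs_filter z.
apply/cvgrPdist_lt => e e0.
have eC : 0 < (e%:C : C) by rewrite ltcR.
have nz : \forall t \near z, `|z - t| < (e%:C : C).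
  by apply/nbhs_normP; exists (e%:C).
near=> t; have zt : `|z - t| < (e%:C : C) by near: t.
by rewrite -realifyN -realifyD -ltcR (le_lt_trans (normr_realify _)).
Unshelve. all: by end_near. Qed.

Lemma complexify_continuous : continuous (@complexify R m).
Proof.
move=> u; have Fu : Filter (nbhs u) := nbhs_filter u.
apply/cvgrPdist_lt => e e0.
have er0 : 0 < complex.Re e by rewrite -ltcR -ge0_complexE ?ltW.
have eR : 0 < complex.Re e / 2 by rewrite divr_gt0.
have nu : \forall t \near u, `|u - t| < complex.Re e / 2.
  by apply/nbhs_normP; exists (complex.Re e / 2).
near=> t; have ut : `|u - t| < complex.Re e / 2 by near: t.
rewrite -complexifyN -complexifyD (le_lt_trans (normr_complexify _))//.
by rewrite (ge0_complexE (ltW e0)) ltcR mulrC -ltr_pdivlMr.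
Unshelve. all: by end_near. Qed.

End Dim.

(** The Cauchy-Riemann criterion. Commutation with i makes the real derivative linear over [Cplx R],
    and the remainder estimate carries over because [realify] and [complexify] change norms by
    bounded factors. *)
Lemma differentiable_complex m n (f : 'rV[C]_m -> 'rV[C]_n) (w : 'rV[C]_m) :
  let g := @realify R n \o f \o @complexify R m in
  differentiable g (realify w) ->
  (forall u, 'd g (realify w) (realify_i u) =
             realify_i ('d g (realify w) u)) ->
  differentiable f w.
Proof.
move=> g dg dgi.
pose L xi := complexify ('d g (realify w) (realify xi)) : 'rV[C]_n.
have Llin : linear L.
  move=> a u v; apply: (can_inj (@realifyK R n)).
  rewrite /L realifyD realifyZ !complexifyK realifyD realifyZ !linearD !linearZ /=.
  by rewrite dgi !complexifyK.
pose LM := GRing.isLinear.Build _ _ _ _ L Llin.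
pose LL : {linear _ -> _} := HB.pack L LM.
have Lc : continuous LL.
  move=> x; apply: (@continuous_comp _ _ _ ('d g (realify w) \o @realify R m) (@complexify R n)).
    apply: (@continuous_comp _ _ _ (@realify R m) ('d g (realify w))).
      exact: realify_continuous.
    by move: (realify x); exact: diff_continuous.
  exact: complexify_continuous.
have H : forall e : C, 0 < e ->
  \forall h \near (0 : 'rV[C]_m), `|f (h + w) - f w - LL h| <= e * `|h|.
  move=> e e0; have er0 : 0 < complex.Re e by rewrite -ltcR -ge0_complexE ?ltW.
  (* A positive [e] of [Cplx R] is real, so [complex.Re e] stands for it; the half absorbs the
     factor 2 of [normr_complexify]. *)
  have er2 : 0 < complex.Re e / 2 by rewrite divr_gt0.
  have F0 : Filter (nbhs (0 : 'rV[C]_m)) := nbhs_filter _.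
  have H := @realify_continuous m 0.
  rewrite /continuous_at realify0 in H.
  have := H _ (diff_eps dg er2); apply: (@filterS _ _ F0) => h Hh.
  have -> : f (h + w) - f w - L h =
      complexify (g (realify h + realify w) - g (realify w) - 'd g (realify w) (realify h)).
    rewrite 2!complexifyD 2!complexifyN -realifyD /g /=.
    by rewrite !realifyK.
  apply: (le_trans (normr_complexify _)).
  have Hh1 : `|g (realify h + realify w) - g (realify w) -
      'd g (realify w) (realify h)| <= complex.Re e / 2 * `|realify h| := Hh.
  have Hh' : 2 * `|g (realify h + realify w) - g (realify w) -
      'd g (realify w) (realify h)| <= complex.Re e * `|realify h| by lra.
  have : ((2 * `|g (realify h + realify w) - g (realify w) -
      'd g (realify w) (realify h)|)%:C : C) <= (complex.Re e * `|realify h|)%:C by rewrite lecR.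
  move/le_trans; apply; rewrite rmorphM /= -ge0_complexE; last exact: ltW.
  by rewrite ler_wpM2l ?normr_realify// ltW.
by have [] := differentiable_epsP Lc H.
Qed.

End RealComplex.

(** * Transition maps of charts inducing the same almost complex structure *)

Section Transition.
Variables (R : realType) (V : normedModType R) (m : nat).
Local Notation C := (Cplx R).

Lemma smooth_on_differentiable (W W' : normedModType R) (A : set W) (f : W -> W') x :
  open A -> smooth_on A f -> A x -> differentiable f x.
Proof.
move=> oA sf Ax; have [U [F [oU Ux sF fF]]] := sf x Ax.
have FF : \forall y \near x, F y = f y.
  have : nbhs x (A `&` U) by apply: open_nbhs_nbhs; split => //; exact: openI.
  by apply: filterS => y [Ay Uy]; rewrite fF.
by have [] := near_eq_diff FF (smooth_differentiable sF Ux).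
Qed.

Lemma open_realify_image (A : set 'rV[C]_m) : open A -> open (@realify R m @` A).
Proof.
move=> oA; have -> : @realify R m @` A = @complexify R m @^-1` A.
  apply/seteqP; split=> [_ [z Az <-]|u Au] /=; first by rewrite realifyK.
  by exists (complexify u) => //; rewrite complexifyK.
by apply: open_comp => // u _; exact: complexify_continuous.
Qed.

(** Here [f] and [g] are inverse charts, [T] the transition map, and [F] a smooth extension of the
    second chart to the ambient space, where alone it can be differentiated. Since 'd F inverts 'd g
    on its image and 'd f = 'd g 'd T, moving [j] through 'd f and then through 'd g moves [i]
    through 'd T. *)
Lemma diff_transition (X : normedModType R) (f g : X -> V) (F : V -> X)
    (T : X -> X) (x : X) (j : V -> V) (i : X -> X) :
  g (T x) = f x ->
  differentiable f x -> differentiable g (T x) -> differentiable F (f x) ->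
  (\forall y \near x, F (f y) = T y) -> (\forall y \near T x, F (g y) = y) ->
  (\forall y \near x, f y = g (T y)) ->
  (forall v, j ('d f x v) = 'd f x (i v)) ->
  (forall v, j ('d g (T x) v) = 'd g (T x) (i v)) ->
  differentiable T x /\ forall v, 'd T x (i v) = i ('d T x v).
Proof.
move=> gTx df dg dF FfT Fg fgT jf jg.
have dFg : differentiable F (g (T x)) by rewrite gTx.
have [dT _] := near_eq_diff FfT (differentiable_comp df dF).
have dTE u : 'd T x u = 'd F (f x) ('d f x u).
  by rewrite -(diff_compE u df dF); exact: near_eq_diffE FfT (differentiable_comp df dF).
have dFgE u : 'd F (f x) ('d g (T x) u) = u.
  rewrite -gTx -(diff_compE u dg dFg) -[RHS](diff_idE (T x) u).
  apply/esym; apply: near_eq_diffE; first exact: Fg.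
  exact: differentiable_comp.
have dgTE u : 'd g (T x) ('d T x u) = 'd f x u.
  by rewrite -(diff_compE u dT dg); exact: near_eq_diffE fgT df.
by split=> // u; rewrite dTE -jf -dgTE jg dFgE.
Qed.

(* The derivative of a transition map commutes with multiplication by i because
   J is multiplication by i in both charts. *)
Lemma holomorphic_transition_of_induced (M : set V) (J : V -> V -> V)
    (c d : complex_chart V m) :
  smooth_chart M c -> smooth_chart M d ->
  induced_by_chart J c -> induced_by_chart J d -> holomorphic_transition c d.
Proof.
move=> [[Oc [_ domc]] oc ck _ sc] [[Od [oO domd]] od dk sfd sd] Jc Jd _ [p [cp dp] <-].
set w := chart_map c p; set x := realify w.
pose psi (e : complex_chart V m) := chart_inv e \o @complexify R m.
pose q := realify (chart_map d p).
have Wx : (@realify R m @` chart_image c) x by exists w => //; exists p.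
have Wq : (@realify R m @` chart_image d) q.
  by exists (chart_map d p) => //; exists p.
have dc : differentiable (psi c) x.
  by apply: smooth_on_differentiable sc Wx; exact: open_realify_image.
have dd : differentiable (psi d) q.
  by apply: smooth_on_differentiable sd Wq; exact: open_realify_image.
have psix : psi c x = p by rewrite /psi /= realifyK ck.
have psiq : psi d q = p by rewrite /psi /= realifyK dk.
have [U [F [oU Up sF fF]]] := sfd p dp.
have dF : differentiable F p := smooth_differentiable sF Up.
have OUp : nbhs p (Od `&` U).
  apply: open_nbhs_nbhs; split; first exact: openI.
  by move: dp; rewrite domd => -[].
have nx : \forall y \near x, chart_dom d (psi c y) /\ U (psi c y).
  have c1 : \forall y \near x, (Od `&` U) (psi c y).
    by apply: (differentiable_continuous dc); rewrite psix.
  have c2 : nbhs x (@realify R m @` chart_image c).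
    by apply: open_nbhs_nbhs; split => //; exact: open_realify_image.
  apply: filterS2 c1 c2 => y [Oy Uy] [_ [r cr <-] yr]; split => //.
  rewrite domd; split => //; rewrite -yr /psi /= realifyK ck//.
  by move: cr; rewrite domc => -[].
have nq : \forall y \near q, F (psi d y) = y.
  have c1 : \forall y \near q, (Od `&` U) (psi d y).
    by apply: (differentiable_continuous dd); rewrite psiq.
  have c2 : nbhs q (@realify R m @` chart_image d).
    by apply: open_nbhs_nbhs; split => //; exact: open_realify_image.
  apply: filterS2 c1 c2 => y [Oy Uy] [_ [r dr <-] yr].
  have psiy : psi d y = r by rewrite -yr /psi /= realifyK dk.
  by move: Uy; rewrite psiy => Ur; rewrite -fF.
pose T := @realify R m \o (chart_map d \o chart_inv c) \o @complexify R m.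
have Tx : T x = q by rewrite /T /= realifyK /q ck.
have nT : \forall y \near x, F (psi c y) = T y.
  by apply: filterS nx => y [dy Uy]; rewrite -fF.
have n1 : \forall y \near x, psi c y = psi d (T y).
  by apply: filterS nx => y [dy Uy]; rewrite /psi /T /= realifyK dk.
have Jcu v : J p ('d (psi c) x v) = 'd (psi c) x (realify_i v).
  have := Jc w (complexify v) (ex_intro2 _ _ p cp erefl).
  by rewrite /= realifyZi complexifyK ck.
have Jdu v : J p ('d (psi d) q v) = 'd (psi d) q (realify_i v).
  have := Jd (chart_map d p) (complexify v) (ex_intro2 _ _ p dp erefl).
  by rewrite /= realifyZi complexifyK dk.
have [] := @diff_transition _ (psi c) (psi d) F T x (J p) (@realify_i R m).
- by rewrite Tx psiq psix.
- exact: dc.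
- by rewrite Tx.
- by rewrite psix.
- exact: nT.
- by rewrite Tx.
- exact: n1.
- exact: Jcu.
- by rewrite Tx.
by move=> dT dTi; exact: (differentiable_complex dT dTi).
Qed.

End Transition.

(** * Octonion multiplication and the almost complex structure *)

Section Octonion.
Variable R : realType.
Implicit Types (u v : 'rV[R]_8) (w : 'rV[R]_7).

Definition dot n (u v : 'rV[R]_n) : R := \sum_i u 0 i * v 0 i.

Lemma dotE n (u v : 'rV[R]_n) : u *m v^T = (dot u v)%:M.
Proof.
by apply/matrixP => i j; rewrite !ord1 !mxE eqxx; apply: eq_bigr => k _; rewrite mxE.
Qed.

Lemma dotC n (u v : 'rV[R]_n) : dot u v = dot v u.
Proof. by apply: eq_bigr => i _; rewrite mulrC. Qed.

Lemma dotDl n (u u' v : 'rV[R]_n) : dot (u + u') v = dot u v + dot u' v.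
Proof. by rewrite /dot -big_split; apply: eq_bigr => i _; rewrite mxE mulrDl. Qed.

Lemma dotZl n a (u v : 'rV[R]_n) : dot (a *: u) v = a * dot u v.
Proof. by rewrite /dot mulr_sumr; apply: eq_bigr => i _; rewrite mxE mulrA. Qed.

Lemma dotDr n (u v v' : 'rV[R]_n) : dot u (v + v') = dot u v + dot u v'.
Proof. by rewrite dotC dotDl !(dotC u). Qed.

Lemma dotZr n a (u v : 'rV[R]_n) : dot u (a *: v) = a * dot u v.
Proof. by rewrite dotC dotZl dotC. Qed.

Lemma dotNl n (u v : 'rV[R]_n) : dot (- u) v = - dot u v.
Proof. by rewrite -scaleN1r dotZl mulN1r. Qed.

Lemma dotNr n (u v : 'rV[R]_n) : dot u (- v) = - dot u v.
Proof. by rewrite dotC dotNl dotC. Qed.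

Definition dot_lin := (dotDl, dotDr, dotZl, dotZr, dotNl, dotNr).

(* The rows are the octonion products of x with the seven imaginary units on the
   right: together with x itself they form an orthogonal frame of R^8. *)
Definition frame_rows (x : nat -> R) : seq (seq R) :=
  [:: [:: - x 1; x 0; x 3; - x 2; x 5; - x 4; - x 7; x 6];
     [:: - x 2; - x 3; x 0; x 1; x 6; x 7; - x 4; - x 5];
     [:: - x 3; x 2; - x 1; x 0; x 7; - x 6; x 5; - x 4];
     [:: - x 4; - x 5; - x 6; - x 7; x 0; x 1; x 2; x 3];
     [:: - x 5; x 4; - x 7; x 6; - x 1; x 0; - x 3; x 2];
     [:: - x 6; x 7; x 4; - x 5; - x 2; x 3; x 0; - x 1];
     [:: - x 7; - x 6; x 5; x 4; - x 3; - x 2; x 1; x 0]].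

Definition frame u : 'M[R]_(7, 8) :=
  \matrix_(i, j) nth 0 (nth [::] (frame_rows (fun k => u 0 (inord k))) i) j.

Local Ltac ord_cases i :=
  case: i => -[|[|[|[|[|[|[|[|i]]]]]]]] // ?.

Lemma frameD u v : frame (u + v) = frame u + frame v.
Proof.
apply/matrixP => i j; rewrite !mxE; ord_cases i; ord_cases j;
  by rewrite /= !mxE ?opprD.
Qed.

Lemma frameZ a u : frame (a *: u) = a *: frame u.
Proof.
apply/matrixP => i j; rewrite !mxE; ord_cases i; ord_cases j;
  by rewrite /= !mxE ?mulrN.
Qed.

Lemma frame_tr u : frame u *m u^T = 0.
Proof.
apply/matrixP => i j; rewrite !mxE.
have E k : u^T k j = u 0 (inord k) by rewrite mxE ord1 inord_val.
under eq_bigr => k _ do rewrite E.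
rewrite !big_ord_recr big_ord0 /= !mxE.
ord_cases i; rewrite /=; ring.
Qed.

Lemma dot_coord u : dot u u = \sum_(k < 8) u 0 (inord k) * u 0 (inord k).
Proof. by apply: eq_bigr => k _; rewrite inord_val. Qed.

Lemma frame_mul_tr u : frame u *m (frame u)^T = (dot u u)%:M.
Proof.
apply/matrixP => i j; rewrite !mxE dot_coord !big_ord_recr !big_ord0 /= !mxE.
ord_cases i; ord_cases j; rewrite /= ?mulr1n ?mulr0n; ring.
Qed.

(** The rows of [frame u] together with [u] are orthogonal and all of squared length [dot u u]; the
    rows therefore resolve the projection onto the complement of [u]. *)
Lemma frame_tr_mul u : (frame u)^T *m frame u = (dot u u)%:M - u^T *m u.
Proof.
apply/matrixP => i j.
have E : (u^T *m u) i j = u 0 (inord i) * u 0 (inord j).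
  by rewrite mxE big_ord1 mxE !inord_val.
rewrite mxE [RHS]mxE [X in _ + X]mxE {}E [(dot u u)%:M i j]mxE dot_coord.
rewrite !big_ord_recr !big_ord0 /= !mxE.
ord_cases i; ord_cases j; rewrite /= ?mulr1n ?mulr0n; ring.
Qed.

Definition omul u w : 'rV[R]_8 := w *m frame u.
(** The transpose of [omul u]. For a unit vector [u] it inverts [omul u] on the orthogonal
    complement of [u]. *)
Definition ocoord u v : 'rV[R]_7 := v *m (frame u)^T.

Lemma omulDl u u' w : omul (u + u') w = omul u w + omul u' w.
Proof. by rewrite /omul frameD mulmxDr. Qed.

Lemma omulDr u w w' : omul u (w + w') = omul u w + omul u w'.
Proof. by rewrite /omul mulmxDl. Qed.

Lemma omulZl a u w : omul (a *: u) w = a *: omul u w.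
Proof. by rewrite /omul frameZ scalemxAr. Qed.

Lemma omulZr a u w : omul u (a *: w) = a *: omul u w.
Proof. by rewrite /omul scalemxAl. Qed.

Lemma ocoordDl u u' v : ocoord (u + u') v = ocoord u v + ocoord u' v.
Proof. by rewrite /ocoord frameD linearD mulmxDr. Qed.

Lemma ocoordDr u v v' : ocoord u (v + v') = ocoord u v + ocoord u v'.
Proof. by rewrite /ocoord mulmxDl. Qed.

Lemma ocoordZl a u v : ocoord (a *: u) v = a *: ocoord u v.
Proof. by rewrite /ocoord frameZ linearZ /= scalemxAr. Qed.

Lemma ocoordZr a u v : ocoord u (a *: v) = a *: ocoord u v.
Proof. by rewrite /ocoord scalemxAl. Qed.

Lemma ocoordNl u v : ocoord (- u) v = - ocoord u v.
Proof. by rewrite -scaleN1r ocoordZl scaleN1r. Qed.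

Lemma ocoordNr u v : ocoord u (- v) = - ocoord u v.
Proof. by rewrite -scaleN1r ocoordZr scaleN1r. Qed.

Lemma omulK u v : omul u (ocoord u v) = dot u u *: v - dot v u *: u.
Proof.
by rewrite /omul /ocoord -mulmxA frame_tr_mul mulmxBr mul_mx_scalar mulmxA dotE
  mul_scalar_mx.
Qed.

Lemma ocoordK u w : ocoord u (omul u w) = dot u u *: w.
Proof. by rewrite /omul /ocoord -mulmxA frame_mul_tr mul_mx_scalar. Qed.

Lemma dot_omull u w : dot (omul u w) u = 0.
Proof.
have := dotE (omul u w) u; rewrite /omul -mulmxA frame_tr mulmx0.
by move=> /matrixP/(_ 0 0); rewrite !mxE.
Qed.

Lemma dot_omul u w w' : dot (omul u w) (omul u w') = dot u u * dot w w'.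
Proof.
have := dotE (omul u w) (omul u w').
rewrite /omul trmx_mul mulmxA -(mulmxA w) frame_mul_tr mul_mx_scalar -scalemxAl dotE.
by move=> /matrixP/(_ 0 0); rewrite !mxE eqxx !mulr1n.
Qed.

Lemma dot_ocoord u v w : dot (ocoord u v) w = dot v (omul u w).
Proof.
have := dotE (ocoord u v) w; rewrite /ocoord -mulmxA -trmx_mul dotE.
by move=> /matrixP/(_ 0 0); rewrite !mxE eqxx !mulr1n.
Qed.

(** Polarisation of [omulK], which is quadratic in [u]. This is what the identity becomes when
    differentiated with [u] moving in the direction [u']; the other polar forms below have the same
    purpose. *)
Lemma omulK_polar u u' v : omul u (ocoord u' v) + omul u' (ocoord u v) =
  (2 * dot u u') *: v - dot v u *: u' - dot v u' *: u.
Proof.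
have := omulK (u + u') v; rewrite ocoordDl !omulDl !omulDr !omulK !dot_lin (dotC u' u).
move=> E; apply/rowP => j; move/rowP/(_ j): E; rewrite !mxE; lra.
Qed.

Lemma ocoordK_polar u u' w : ocoord u (omul u' w) + ocoord u' (omul u w) =
  (2 * dot u u') *: w.
Proof.
have := ocoordK (u + u') w; rewrite omulDl !ocoordDl !ocoordDr !ocoordK !dot_lin (dotC u' u).
move=> E; apply/rowP => j; move/rowP/(_ j): E; rewrite !mxE; lra.
Qed.

Lemma dot_omull_polar u u' w : dot (omul u w) u' + dot (omul u' w) u = 0.
Proof. by have := dot_omull (u + u') w; rewrite omulDl !dot_lin !dot_omull add0r addr0. Qed.

Lemma dot_omul_polar u u' w :
  dot (omul u w) (omul u' w) = dot u u' * dot w w.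
Proof.
have := dot_omul (u + u') w w; rewrite omulDl !dot_lin !dot_omul (dotC u' u).
rewrite (dotC (omul u' w)); lra.
Qed.

End Octonion.

(* A point ((c, s), u, w) is sent to e^t (u + i v) with (c, s) = (cos t, sin t) and
   v = omul u w; multiplication by i on the cone of the z in C^8 with
   sum_i z_i^2 = 0 gives the formulas for the derivatives of t, u and v, and w is
   recovered as ocoord u v. *)
Section Structure.
Variable R : realType.
Local Notation V := ('rV[R]_2 * 'rV[R]_8 * 'rV[R]_7)%type.
Implicit Types p t : V.

Definition rot (e : 'rV[R]_2) : 'rV[R]_2 :=
  \row_j (if j == 0 then - e 0 1 else e 0 0).

(** The derivative of v = [omul u w] along [t]; likewise [angle_diff] is the derivative of the angle
    of the circle factor. *)
Definition vdiff p t : 'rV[R]_8 := omul t.1.2 p.2 + omul p.1.2 t.2.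

Definition angle_diff p t : R := dot (rot p.1.1) t.1.1.

(** Multiplying the derivative of e^t (u + i v) by i determines the new derivatives of u and v up to
    that of t. The latter is fixed by keeping the derivative of u orthogonal to u, which gives minus
    the product of dv with u; this equals the product of v with du because v and u stay
    orthogonal. *)
Definition Jangle p t : R := dot (omul p.1.2 p.2) t.1.2.

Definition Ju p t : 'rV[R]_8 := - (angle_diff p t *: omul p.1.2 p.2) - vdiff p t -
  Jangle p t *: p.1.2.

Definition Jv p t : 'rV[R]_8 := angle_diff p t *: p.1.2 + t.1.2 -
  Jangle p t *: omul p.1.2 p.2.

(** The last component is the derivative of w = [ocoord u v] by the product rule, with [Ju] and [Jv]
    as derivatives of u and v. *)
Definition octJ p t : V :=
  (Jangle p t *: rot p.1.1, Ju p t,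
   ocoord p.1.2 (Jv p t) + ocoord (Ju p t) (omul p.1.2 p.2)).

Definition tangent p t : Prop :=
  [/\ dot p.1.1 t.1.1 = 0, dot p.1.2 t.1.2 = 0 & dot p.2 t.2 = 0].

Definition sphere_prod : set V := sphere R 1 `*` sphere R 7 `*` sphere R 6.

Lemma sphereE n (x : 'rV[R]_n.+1) : sphere R n x <-> dot x x = 1.
Proof. by rewrite /sphere /=; under eq_bigr => i _ do rewrite expr2. Qed.

Lemma dot2E (e e' : 'rV[R]_2) : dot e e' = e 0 0 * e' 0 0 + e 0 1 * e' 0 1.
Proof.
rewrite /dot !big_ord_recl big_ord0 addr0.
by have -> : lift ord0 ord0 = 1 :> 'I_2 by exact: val_inj.
Qed.

Lemma row2P (e e' : 'rV[R]_2) : e 0 0 = e' 0 0 -> e 0 1 = e' 0 1 -> e = e'.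
Proof.
move=> e0 e1; apply/rowP => -[[|[|//]] Hi].
  by rewrite (_ : Ordinal Hi = 0)//; exact: val_inj.
by rewrite (_ : Ordinal Hi = 1)//; exact: val_inj.
Qed.

Lemma rotE (e : 'rV[R]_2) : rot e 0 0 = - e 0 1 /\ rot e 0 1 = e 0 0.
Proof. by rewrite !mxE. Qed.

Lemma dot_rot e e' : dot (rot e) (rot e') = dot e e'.
Proof. by rewrite !dot2E !(rotE _).1 !(rotE _).2; ring. Qed.

Lemma dot_rotl e : dot (rot e) e = 0.
Proof. by rewrite !dot2E !(rotE _).1 !(rotE _).2; ring. Qed.

Lemma rot_frame e e' : dot e e *: e' = dot e e' *: e + dot (rot e) e' *: rot e.
Proof.
by apply: row2P; rewrite !dot2E !(mxE, (rotE _).1, (rotE _).2) /=; ring.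
Qed.

Section Point.
Variables (p t : V).
Hypotheses (Mp : sphere_prod p) (Tt : tangent p t).
Local Notation u := p.1.2.
Local Notation v := (omul p.1.2 p.2).

Let ee : dot p.1.1 p.1.1 = 1. Proof. by case: Mp => -[/sphereE]. Qed.
Let uu : dot u u = 1. Proof. by case: Mp => -[_ /sphereE]. Qed.
Let ww : dot p.2 p.2 = 1. Proof. by case: Mp => _ /sphereE. Qed.
Let vu : dot v u = 0. Proof. exact: dot_omull. Qed.
Let vv : dot v v = 1. Proof. by rewrite dot_omul uu ww mulr1. Qed.
Let uu' : dot t.1.2 u = 0. Proof. by case: Tt => _; rewrite dotC. Qed.
(** [vdu] and [vdv] are the differentiated forms of the orthogonality of v and u and of v having
    length 1. *)
Let vdu : dot (vdiff p t) u = - dot v t.1.2.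
Proof.
rewrite /vdiff dotDl dot_omull addr0; apply/eqP; rewrite -addr_eq0 addrC.
by rewrite dot_omull_polar.
Qed.
Let vdv : dot (vdiff p t) v = 0.
Proof.
case: Tt => _ h1 h2; rewrite /vdiff dotDl dot_omul_polar dot_omul uu'.
by rewrite (dotC t.2) h2 !mulr0 mul0r addr0.
Qed.
Let Juu : dot (Ju p t) u = 0.
Proof.
by rewrite /Ju; move: (vdiff p t) vdu => d du; rewrite !dot_lin vu uu du /Jangle; ring.
Qed.
Let Jvv : dot (Jv p t) v = 0.
Proof. by rewrite /Jv !dot_lin (dotC u) vu vv /Jangle (dotC t.1.2); ring. Qed.
Let JvJu : dot (Jv p t) u + dot v (Ju p t) = 0.
Proof.
rewrite /Jv /Ju; move: (vdiff p t) vdv => d; rewrite dotC => dv.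
by rewrite !dot_lin vu vv uu uu' dv; ring.
Qed.

(** A consistency check: the last component of [octJ] came from w = [ocoord u v], and
    differentiating v = [omul u w] returns [Jv]. It holds because [Ju] and [Jv] respect the
    relations between u and v, through [Juu] and [JvJu]. *)
Lemma vdiff_J : vdiff p (octJ p t) = Jv p t.
Proof.
rewrite /vdiff /= omulDr omulK uu scale1r.
have := omulK_polar u (Ju p t) v; rewrite ocoordK uu scale1r (dotC u) Juu vu.
move=> E; apply/rowP => j; move/rowP/(_ j): E; move: JvJu; rewrite !mxE.
set a := dot (Jv p t) u; set b := dot v (Ju p t) => /eqP; rewrite addr_eq0 => /eqP ->.
by move=> E; have := E; lra.
Qed.

Lemma tangent_J : tangent p (octJ p t).
Proof.
split.
- by rewrite /= dotZr dotC dot_rotl mulr0.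
- by rewrite /= dotC Juu.
have := dot_omul u p.2 (octJ p t).2; rewrite uu mul1r => <-.
have -> : omul u (octJ p t).2 = Jv p t - omul (Ju p t) p.2.
  by rewrite -vdiff_J /vdiff addrAC subrr add0r.
rewrite dotDr dotNr (dotC v) Jvv sub0r.
by rewrite dot_omul_polar (dotC u) Juu mul0r oppr0.
Qed.

(** On the derivatives of t, u and v the map is multiplication by i, so its square is visibly -1
    there; [ocoordK_polar] then brings the sign back to the component in S^6. *)
Lemma octJ_octJ : octJ p (octJ p t) = - t.
Proof.
have angJ : angle_diff p (octJ p t) = Jangle p t.
  by rewrite /angle_diff /= dotZr dot_rot ee mulr1.
have JangJ : Jangle p (octJ p t) = - angle_diff p t.
  rewrite {1}/Jangle /= /Ju; move: (vdiff p t) vdv => d; rewrite dotC => dv.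
  by rewrite !dot_lin vv vu dv; ring.
have JuJ : Ju p (octJ p t) = - t.1.2.
  by rewrite /Ju angJ JangJ vdiff_J /Jv; apply/rowP => j; rewrite !mxE; ring.
have JvJ : Jv p (octJ p t) = - vdiff p t.
  by rewrite /Jv angJ JangJ /= /Ju; apply/rowP => j; rewrite !mxE; ring.
case: Tt => h1 h2 h3.
rewrite {1}/octJ JangJ JuJ JvJ; congr (_, _, _).
- by rewrite scaleNr; have := rot_frame p.1.1 t.1.1; rewrite ee h1 scale1r scale0r add0r => <-.
rewrite ocoordNl ocoordNr -opprD /vdiff ocoordDr ocoordK uu scale1r addrAC.
by rewrite ocoordK_polar h2 mulr0 scale0r add0r.
Qed.

End Point.

Lemma octJ_linear p (a : R) t t' : octJ p (a *: t + t') = a *: octJ p t + octJ p t'.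
Proof.
have Ha : angle_diff p (a *: t + t') = a * angle_diff p t + angle_diff p t'.
  by rewrite /angle_diff /= !dot_lin.
have Hj : Jangle p (a *: t + t') = a * Jangle p t + Jangle p t'.
  by rewrite /Jangle /= !dot_lin.
have Hv : vdiff p (a *: t + t') = a *: vdiff p t + vdiff p t'.
  by rewrite /vdiff /= omulDl omulDr omulZl omulZr scalerDr addrACA.
have HJu : Ju p (a *: t + t') = a *: Ju p t + Ju p t'.
  by rewrite /Ju Ha Hj Hv; apply/rowP => j; rewrite !mxE; ring.
have HJv : Jv p (a *: t + t') = a *: Jv p t + Jv p t'.
  by rewrite /Jv Ha Hj; apply/rowP => j; rewrite !mxE; ring.
rewrite /octJ HJu HJv Hj {Ha Hv HJu HJv Hj}.
move: (Ju p t) (Ju p t') (Jv p t) (Jv p t') => x x' y y'; congr (_, _, _).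
  by rewrite scalerDl -scalerA.
by rewrite !ocoordDl !ocoordDr ocoordZl ocoordZr addrACA -scalerDr.
Qed.

End Structure.

(** * Smooth maps into products and spaces of row vectors *)

Section SmoothMore.
Variable R : realType.

(** A predicate on plain functions, so that projections and coordinates compose without being packed
    as linear maps at each step. *)
Definition continuous_linear (V W : normedModType R) (f : V -> W) : Prop :=
  linear f /\ continuous f.

Section Linear.
Variables V W : normedModType R.

Lemma continuous_linear_pack (f : V -> W) : continuous_linear f ->
  exists g : {linear V -> W}, (g : V -> W) = f.
Proof.
move=> [fl _]; pose fM := GRing.isLinear.Build _ _ _ _ f fl.
by pose g : {linear _ -> _} := HB.pack f fM; exists g.
Qed.

Lemma smooth_continuous_linear U (f : V -> W) : continuous_linear f -> smooth U f.
Proof.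
move=> fl; have [g gf] := continuous_linear_pack fl; rewrite -gf.
by apply: smooth_linear; rewrite gf; exact: fl.2.
Qed.

Lemma diff_continuous_linear (f : V -> W) x v : continuous_linear f ->
  differentiable f x /\ 'd f x v = f v.
Proof.
move=> fl; have [g gf] := continuous_linear_pack fl; rewrite -gf.
have gc : continuous g by rewrite gf; exact: fl.2.
split; first exact: linear_differentiable.
exact: (f_equal (fun h : V -> W => h v) (diff_lin x gc)).
Qed.

Lemma diff_linear_comp (U : normedModType R) (L : V -> W) (f : U -> V) x v :
  continuous_linear L -> differentiable f x ->
  differentiable (fun y => L (f y)) x /\ 'd (fun y => L (f y)) x v = L ('d f x v).
Proof.
move=> Ll df; have [dL dLE] := diff_continuous_linear (f x) ('d f x v) Ll.
split; first exact: differentiable_comp.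
by rewrite -dLE -(diff_compE v df dL).
Qed.

End Linear.

Lemma continuous_linear_id (V : normedModType R) : continuous_linear (@id V).
Proof. by split=> // x; exact. Qed.

Lemma continuous_linear_comp (U V W : normedModType R) (f : U -> V) (g : V -> W) :
  continuous_linear f -> continuous_linear g -> continuous_linear (fun x => g (f x)).
Proof.
move=> [fl fc] [gl gc]; split=> [a x y|x]; first by rewrite fl gl.
by apply: (@continuous_comp _ _ _ f g); [exact: fc|exact: gc].
Qed.

Lemma continuous_linear_fst (V W : normedModType R) :
  continuous_linear (fun x : V * W => x.1).
Proof. by split=> // x; exact: cvg_fst. Qed.

Lemma continuous_linear_snd (V W : normedModType R) :
  continuous_linear (fun x : V * W => x.2).
Proof. by split=> // x; exact: cvg_snd. Qed.

Lemma continuous_linear_coord n (j : 'I_n) :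
  continuous_linear (fun x : 'rV[R]_n => x 0 j).
Proof. by split=> [a x y|]; [rewrite !mxE|exact: coord_continuous]. Qed.

Section Rows.
Variable V : normedModType R.
Implicit Types (U : set V).

Lemma Ck_on_pair (W W' : normedModType R) k U (f : V -> W) (g : V -> W') :
  open U -> Ck_on k U f -> Ck_on k U g -> Ck_on k U (fun x => (f x, g x)).
Proof.
move=> oU; elim: k f g => [|k IH] f g Cf Cg.
  by move=> x Ux; apply: cvg_pair; [exact: Cf|exact: Cg].
case: Cf Cg => df Cf [dg Cg]; split=> [x Ux|v].
  exact: differentiable_pair (df _ Ux) (dg _ Ux).
apply: (Ck_on_eq oU _ (IH _ _ (Cf v) (Cg v))) => x Ux.
exact: (f_equal (fun h : V -> W * W' => h v) (esym (diff_pair (df _ Ux) (dg _ Ux)))).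
Qed.

Lemma smooth_pair (W W' : normedModType R) U (f : V -> W) (g : V -> W') :
  open U -> smooth U f -> smooth U g -> smooth U (fun x => (f x, g x)).
Proof. by move=> oU sf sg k; exact: Ck_on_pair. Qed.

(** Smoothness entry by entry reduces maps built from [dot], [omul] and [ocoord] to sums and
    products of real functions; [row_smoothP] reassembles the row. *)
Definition row_smooth n U (f : V -> 'rV[R]_n) : Prop :=
  forall j, smooth U (fun x => f x 0 j).

Lemma row_smoothP n U (f : V -> 'rV[R]_n) : open U -> row_smooth U f -> smooth U f.
Proof.
move=> oU sf.
have sS : smooth U (fun x => \sum_j f x 0 j *: (delta_mx 0 j : 'rV[R]_n)).
  have sj j : smooth U (fun x => f x 0 j *: (delta_mx 0 j : 'rV[R]_n)) by exact: smoothZl.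
  exact: smooth_sum oU sj.
by apply: (smooth_eq oU _ sS) => x _; rewrite -row_sum_delta.
Qed.

Lemma row_smooth_linear n U (f : V -> 'rV[R]_n) : continuous_linear f -> row_smooth U f.
Proof.
move=> fl j; apply: smooth_continuous_linear.
exact: continuous_linear_comp fl (continuous_linear_coord j).
Qed.

Lemma row_smoothD n U (f g : V -> 'rV[R]_n) : open U ->
  row_smooth U f -> row_smooth U g -> row_smooth U (fun x => f x + g x).
Proof.
move=> oU sf sg j; apply: (smooth_eq oU _ (smoothD oU (sf j) (sg j))) => x _.
by rewrite mxE.
Qed.

Lemma row_smoothN n U (f : V -> 'rV[R]_n) : open U ->
  row_smooth U f -> row_smooth U (fun x => - f x).
Proof.
move=> oU sf j; apply: (smooth_eq oU _ (smoothN oU (sf j))) => x _.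
by rewrite mxE.
Qed.

Lemma row_smoothZ n U (a : V -> R) (f : V -> 'rV[R]_n) : open U ->
  smooth U a -> row_smooth U f -> row_smooth U (fun x => a x *: f x).
Proof.
move=> oU sa sf j; apply: (smooth_eq oU _ (smoothM oU sa (sf j))) => x _.
by rewrite mxE.
Qed.

Lemma smooth_dot n U (f g : V -> 'rV[R]_n) : open U ->
  row_smooth U f -> row_smooth U g -> smooth U (fun x => dot (f x) (g x)).
Proof.
move=> oU sf sg.
apply: (@smooth_sum _ _ _ U n (fun i x => f x 0 i * g x 0 i) oU) => i.
exact: smoothM.
Qed.

Lemma smooth_frame U (f : V -> 'rV[R]_8) i j : open U -> row_smooth U f ->
  smooth U (fun x => frame (f x) i j).
Proof.
move=> oU sf.
have E x : frame (f x) i j =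
    nth 0 (nth [::] (frame_rows (fun k => f x 0 (inord k))) i) j by rewrite mxE.
apply: (smooth_eq oU (fun x _ => esym (E x))) => {E}.
case: i => -[|[|[|[|[|[|[|i]]]]]]] // ?; case: j => -[|[|[|[|[|[|[|[|j]]]]]]]] // ?;
  try (exact: sf); apply: smoothN => //; exact: sf.
Qed.

Lemma row_smooth_omul U (f : V -> 'rV[R]_8) (g : V -> 'rV[R]_7) : open U ->
  row_smooth U f -> row_smooth U g -> row_smooth U (fun x => omul (f x) (g x)).
Proof.
move=> oU sf sg j.
have sS : smooth U (fun x => \sum_i g x 0 i * frame (f x) i j).
  apply: (@smooth_sum _ _ _ U _ (fun i x => g x 0 i * frame (f x) i j) oU) => i.
  by apply: smoothM => //; exact: smooth_frame.
by apply: (smooth_eq oU _ sS) => x _; rewrite mxE.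
Qed.

Lemma row_smooth_ocoord U (f g : V -> 'rV[R]_8) : open U ->
  row_smooth U f -> row_smooth U g -> row_smooth U (fun x => ocoord (f x) (g x)).
Proof.
move=> oU sf sg j.
have sS : smooth U (fun x => \sum_i g x 0 i * frame (f x) j i).
  apply: (@smooth_sum _ _ _ U _ (fun i x => g x 0 i * frame (f x) j i) oU) => i.
  by apply: smoothM => //; exact: smooth_frame.
apply: (smooth_eq oU _ sS) => x _; rewrite mxE; apply: eq_bigr => i _.
by rewrite [in RHS]mxE.
Qed.

Lemma row_smooth_rot U (f : V -> 'rV[R]_2) : open U ->
  row_smooth U f -> row_smooth U (fun x => rot (f x)).
Proof.
move=> oU sf j; have [j0|j1] := eqVneq j 0.
  apply: (smooth_eq oU _ (smoothN oU (sf 1))) => x _; by rewrite mxE j0.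
by apply: (smooth_eq oU _ (sf 0)) => x _; rewrite mxE (negPf j1).
Qed.

Lemma smooth_on_smooth (W : normedModType R) (A U : set V) (f : V -> W) :
  open U -> A `<=` U -> smooth U f -> smooth_on A f.
Proof. by move=> oU AU sf x Ax; exists U, f; split=> //; exact: AU. Qed.

Lemma diff_sumE n (f : 'I_n -> V -> R) x v : (forall i, differentiable (f i) x) ->
  differentiable (fun y => \sum_i f i y) x /\
  'd (fun y => \sum_i f i y) x v = \sum_i 'd (f i) x v.
Proof.
elim: n f => [|n IH] f df.
  have -> : (fun y => \sum_i f i y) = cst 0 by apply/funext => y; rewrite big_ord0.
  split; first exact: differentiable_cst.
  by rewrite big_ord0 (f_equal (fun h : V -> R => h v) (diff_cst _ _)).
have [dS dSE] := IH (fun i => f (lift ord0 i)) (fun i => df _).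
have -> : (fun y => \sum_i f i y) =
    (fun y => f ord0 y + \sum_(i < n) f (lift ord0 i) y).
  by apply/funext => y; rewrite big_ord_recl.
split; first exact: (differentiableD (df ord0) dS).
by apply: (etrans (diffDE v (df ord0) dS)); rewrite dSE big_ord_recl.
Qed.

Lemma diff_dot n (f g : V -> 'rV[R]_n) x v :
  differentiable f x -> differentiable g x ->
  'd (fun y => dot (f y) (g y)) x v = dot (f x) ('d g x v) + dot ('d f x v) (g x).
Proof.
move=> df dg.
have D (h : V -> 'rV[R]_n) i := @diff_linear_comp _ _ _ _ h x v (continuous_linear_coord i).
have [_ ->] := @diff_sumE n (fun i y => f y 0 i * g y 0 i) x v
  (fun i => differentiableM (D f i df).1 (D g i dg).1).
rewrite /dot -big_split; apply: eq_bigr => i _.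
apply: (etrans (diffME v (D f i df).1 (D g i dg).1)).
have E : forall a b a' b' c d : R, a = a' -> b = b' -> c * a + d * b = c * a' + b' * d.
  by move=> a b a' b' c d -> ->; rewrite (mulrC d).
exact: E (D g i dg).2 (D f i df).2.
Qed.

End Rows.

End SmoothMore.

(** * Tangent spaces *)

Section AlmostComplex.
Variable R : realType.
Local Notation V := ('rV[R]_2 * 'rV[R]_8 * 'rV[R]_7)%type.
Implicit Types p t : V.

Lemma continuous_linear_circle : continuous_linear (fun p : V => p.1.1).
Proof. exact: continuous_linear_comp (continuous_linear_fst _ _) (continuous_linear_fst _ _). Qed.

Lemma continuous_linear_sphere7 : continuous_linear (fun p : V => p.1.2).
Proof. exact: continuous_linear_comp (continuous_linear_fst _ _) (continuous_linear_snd _ _). Qed.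

Lemma continuous_linear_sphere6 : continuous_linear (fun p : V => p.2).
Proof. exact: continuous_linear_snd. Qed.

(** A curve on a sphere has constant squared length, whose derivative is twice the product of
    position and velocity. [L] is meant for the projection to one factor of the product. *)
Lemma diff_sphere (W : normedModType R) n (L : W -> 'rV[R]_n) (g : R -> W) (t : W) :
  continuous_linear L -> is_derive (0 : R) 1 g t ->
  (\forall s \near (0 : R), dot (L (g s)) (L (g s)) = 1) -> dot (L (g 0)) (L t) = 0.
Proof.
move=> Ll [dg gt] nL; have dg' := dg; move/derivable1_diffP: dg' => dg'.
have gt' : 'd g 0 1 = t by rewrite -gt deriveE.
have [dL dLE] := @diff_linear_comp _ _ _ _ _ g 0 1 Ll dg'.
have E : 'd (fun s => dot (L (g s)) (L (g s))) 0 1 =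
    dot (L (g 0)) ('d (fun s => L (g s)) 0 1) + dot ('d (fun s => L (g s)) 0 1) (L (g 0)).
  exact: diff_dot.
have nL' : \forall s \near (0 : R), cst 1 s = dot (L (g s)) (L (g s)).
  by apply: filterS nL => s ->.
have : 'd (fun s => dot (L (g s)) (L (g s))) 0 1 = 0.
  apply: etrans (near_eq_diffE _ nL' (differentiable_cst _ _)) _.
  exact: diff_cstE.
move/(etrans (esym E)); rewrite dLE gt' (dotC (L t)) => /eqP.
by rewrite -mulr2n mulrn_eq0 /= => /eqP.
Qed.

(* Stereographic parametrisation of the great circle through e in the direction d. *)
Definition great_circle n (e d : 'rV[R]_n) (s : R) : 'rV[R]_n :=
  (1 + dot d d / 4 * (s * s))^-1 *: ((1 - dot d d / 4 * (s * s)) *: e + s *: d).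

Section GreatCircle.
Variables (n : nat) (e d : 'rV[R]_n).

Let den_neq0 (s : R) : 1 + dot d d / 4 * (s * s) != 0.
Proof.
have dd : 0 <= dot d d by apply: sumr_ge0 => i _; rewrite -expr2 sqr_ge0.
by apply: lt0r_neq0; have := sqr_ge0 s; rewrite expr2; nra.
Qed.

Lemma dot_great_circle s : dot e e = 1 -> dot e d = 0 ->
  dot (great_circle e d s) (great_circle e d s) = 1.
Proof.
move=> ee ed; have := den_neq0 s; rewrite /great_circle.
(* With c = |d|^2 / 4 the claim is (1 - c s^2)^2 + 4 c s^2 = (1 + c s^2)^2; this is where the 4
   comes from. *)
have dE : dot d d = 4 * (dot d d / 4) by rewrite mulrC divfK// pnatr_eq0.
rewrite dotZl dotZr !dot_lin (dotC d e) ee ed.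
move: dE; set c := dot d d / 4 => ->; set D := 1 + c * (s * s) => D0.
do 2![apply: (mulfI D0); rewrite mulVKf//].
by rewrite /D; ring.
Qed.

Lemma great_circle0 : great_circle e d 0 = e.
Proof.
by rewrite /great_circle mul0r mulr0 addr0 subr0 invr1 !scale1r scale0r addr0.
Qed.

Let smooth_id : smooth setT (@id R).
Proof. exact/smooth_continuous_linear/continuous_linear_id. Qed.

Let smooth_quad : smooth setT (fun s : R => dot d d / 4 * (s * s)).
Proof.
by apply: smoothM (smoothM _ smooth_id smooth_id); [exact: openT|exact: smooth_cst|exact: openT].
Qed.

Let smooth_den : smooth setT (fun s : R => (1 + dot d d / 4 * (s * s))^-1).
Proof.
apply: (smooth_comp openT (@smooth_inv R)) => [s _|]; first exact: den_neq0.
exact: smoothD openT (smooth_cst _ _) smooth_quad.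
Qed.

Let smooth_num : row_smooth setT (fun s : R => (1 - dot d d / 4 * (s * s)) *: e + s *: d).
Proof.
apply: row_smoothD; first exact: openT.
  apply: row_smoothZ; [exact: openT| |by move=> j; exact: smooth_cst].
  exact: smoothB openT (smooth_cst _ _) smooth_quad.
apply: row_smoothZ; [exact: openT|exact: smooth_id|by move=> j; exact: smooth_cst].
Qed.

Lemma row_smooth_great_circle : row_smooth setT (great_circle e d).
Proof. exact: row_smoothZ openT smooth_den smooth_num. Qed.

(** Apart from [s *: d] the parameter enters only through its square, so the denominator and the
    coefficient of [e] have derivative zero at 0. *)
Lemma diff_great_circle : 'd (great_circle e d) 0 1 = d.
Proof.
have D (W : normedModType R) (f : R -> W) (sf : smooth setT f) := smooth_differentiable (x := 0) sf I.
have Z1 (a b : R) : a = 0 -> a * b = 0 by move=> ->; rewrite mul0r.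
have Z2 (a b : R) : a = 0 -> b = 0 -> a + b = 0 by move=> -> ->; rewrite addr0.
have Z3 (a b : R) : b = 0 -> a * b = 0 by move=> ->; rewrite mulr0.
have dss : 'd (fun s : R => s * s) 0 1 = 0.
  apply: (etrans (diffME _ (D _ _ smooth_id) (D _ _ smooth_id))).
  by apply: Z2; exact: Z1.
have dsm : smooth setT (fun s : R => s * s) := smoothM openT smooth_id smooth_id.
have dq : 'd (fun s : R => dot d d / 4 * (s * s)) 0 1 = 0.
  apply: (etrans (diffME _ (differentiable_cst _ _) (D _ _ dsm))).
  by apply: Z2; [exact: Z3|apply: Z1; rewrite mulr0].
have sD : smooth setT (fun s : R => 1 + dot d d / 4 * (s * s)).
  exact: smoothD openT (smooth_cst _ _) smooth_quad.
have dD : 'd (fun s : R => 1 + dot d d / 4 * (s * s)) 0 1 = 0.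
  apply: (etrans (diffDE _ (differentiable_cst _ _) (D _ _ smooth_quad))).
  exact: Z2 (diff_cstE _ _ _) dq.
have dden : 'd (fun s : R => (1 + dot d d / 4 * (s * s))^-1) 0 1 = 0.
  apply: (etrans (diff_comp1 _ (D _ _ sD) (differentiable_Rinv (den_neq0 0)))).
  exact: Z1 dD.
have dG : differentiable (great_circle e d) 0.
  exact: D (row_smoothP openT row_smooth_great_circle).
apply/rowP => j.
have dGj : 'd (fun s => great_circle e d s 0 j) 0 1 = ('d (great_circle e d) 0 1) 0 j.
  by have [_ ->] := @diff_linear_comp R _ _ (R : normedModType R) _ (great_circle e d) 0 1
    (continuous_linear_coord R j) dG.
rewrite -dGj.
have GE : (fun s => great_circle e d s 0 j) =
    (fun s => (1 + dot d d / 4 * (s * s))^-1 * ((1 - dot d d / 4 * (s * s)) * e 0 j + s * d 0 j)).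
  by apply/funext => s; rewrite !mxE.
rewrite GE.
have s1 : smooth setT (fun s : R => 1 - dot d d / 4 * (s * s)).
  exact: smoothB openT (smooth_cst _ _) smooth_quad.
have d1 : 'd (fun s : R => 1 - dot d d / 4 * (s * s)) 0 1 = 0.
  apply: (etrans (diffBE _ (differentiable_cst _ _) (D _ _ smooth_quad))).
  by apply: Z2; [exact: diff_cstE|apply/eqP; rewrite oppr_eq0; apply/eqP; exact: dq].
have s2 : smooth setT (fun s : R => (1 - dot d d / 4 * (s * s)) * e 0 j).
  exact: smoothM openT s1 (smooth_cst _ _).
have d2 : 'd (fun s : R => (1 - dot d d / 4 * (s * s)) * e 0 j) 0 1 = 0.
  apply: (etrans (diffME _ (D _ _ s1) (differentiable_cst _ _))).
  by apply: Z2; apply: Z3; [exact: diff_cstE|exact: d1].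
have s3 : smooth setT (fun s : R => s * d 0 j).
  exact: smoothM openT smooth_id (smooth_cst _ _).
have d3 : 'd (fun s : R => s * d 0 j) 0 1 = d 0 j.
  apply: (etrans (diffME _ (D _ _ smooth_id) (differentiable_cst _ _))).
  have E (a b c : R) : a = 0 -> b = 1 -> 0 * a + c * b = c.
    by move=> -> ->; rewrite mulr0 add0r mulr1.
  by apply: E; [exact: diff_cstE|exact: diff_idE].
apply: (etrans (diffME _ (D _ _ smooth_den) (D _ _ (smoothD openT s2 s3)))).
have E (a b c x y : R) : a = 1 -> b = x -> c = 0 -> a * b + y * c = x.
  by move=> -> -> ->; rewrite mulr0 addr0 mul1r.
apply: E; [by rewrite mul0r mulr0 addr0 invr1| |exact: dden].
apply: (etrans (diffDE _ (D _ _ s2) (D _ _ s3))).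
have E2 (a b x : R) : a = 0 -> b = x -> a + b = x by move=> -> ->; rewrite add0r.
exact: E2.
Qed.

End GreatCircle.

Lemma tangent_of_tangent_space p t : tangent_space (@sphere_prod R) p t -> tangent p t.
Proof.
move=> [g [I [oI I0 _ gM [<- dg]]]].
have nI : \forall s \near (0 : R), sphere_prod (g s).
  by apply: filterS (open_nbhs_nbhs (conj oI I0)) => s; exact: gM.
split.
- apply: (diff_sphere continuous_linear_circle dg).
  by apply: filterS nI => s [[/sphereE]].
- apply: (diff_sphere continuous_linear_sphere7 dg).
  by apply: filterS nI => s [[_ /sphereE]].
- apply: (diff_sphere continuous_linear_sphere6 dg).
  by apply: filterS nI => s [_ /sphereE].
Qed.

(** The curve runs along a great circle in each factor. The rational parametrisation needs no unit
    direction, so components of [t] that vanish require no separate case. *)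
Lemma tangent_space_of_tangent p t : sphere_prod p -> tangent p t -> tangent_space (@sphere_prod R) p t.
Proof.
move=> [[/sphereE m1 /sphereE m2] /sphereE m3] [t1 t2 t3].
pose g (s : R) : V := (great_circle p.1.1 t.1.1 s, great_circle p.1.2 t.1.2 s,
  great_circle p.2 t.2 s).
have s1 := row_smoothP openT (row_smooth_great_circle p.1.1 t.1.1).
have s2 := row_smoothP openT (row_smooth_great_circle p.1.2 t.1.2).
have s3 := row_smoothP openT (row_smooth_great_circle p.2 t.2).
have s12 := smooth_pair openT s1 s2.
have sg : smooth setT g := smooth_pair openT s12 s3.
exists g, setT; split; [exact: openT|by []| | |split].
- exact: smooth_on_smooth openT _ sg.
- by move=> s _; split; [split|]; apply/sphereE; exact: dot_great_circle.
- by rewrite /g !great_circle0; case: (p) => [[]].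
have D (W : normedModType R) (f : R -> W) (sf : smooth setT f) :=
  smooth_differentiable (x := 0) sf Logic.I.
have dg := D _ _ sg.
have gt : 'd g 0 1 = t.
  have E : 'd g 0 1 = ('d (great_circle p.1.1 t.1.1) 0 1,
      'd (great_circle p.1.2 t.1.2) 0 1, 'd (great_circle p.2 t.2) 0 1).
    apply: (etrans (f_equal (fun h : R -> V => h 1) (diff_pair (D _ _ s12) (D _ _ s3)))).
    congr pair.
    exact: (f_equal (fun h : R -> _ => h 1) (diff_pair (D _ _ s1) (D _ _ s2))).
  by rewrite E !diff_great_circle; case: (t) => [[]].
split; first exact/derivable1_diffP.
by rewrite deriveE.
Qed.

(** The formulas make sense for all pairs, so smoothness on the tangent bundle is obtained by
    restriction from the whole of [V * V]. *)
Lemma smooth_J : smooth setT (fun pt : V * V => octJ pt.1 pt.2).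
Proof.
have c1 := continuous_linear_fst V V; have c2 := continuous_linear_snd V V.
have L n (f : V -> 'rV[R]_n) (fl : continuous_linear f) :
    row_smooth setT (fun pt : V * V => f pt.1) /\ row_smooth setT (fun pt : V * V => f pt.2).
  by split; apply: row_smooth_linear;
    [exact: continuous_linear_comp c1 fl|exact: continuous_linear_comp c2 fl].
have [e e'] := L _ _ continuous_linear_circle.
have [u u'] := L _ _ continuous_linear_sphere7.
have [w w'] := L _ _ continuous_linear_sphere6.
have oT : open [set: V * V] by exact: openT.
have v := row_smooth_omul oT u w.
have sa : smooth setT (fun pt : V * V => angle_diff pt.1 pt.2).
  exact: smooth_dot oT (row_smooth_rot oT e) e'.
have sj : smooth setT (fun pt : V * V => Jangle pt.1 pt.2).
  exact: smooth_dot oT v u'.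
have sv : row_smooth setT (fun pt : V * V => vdiff pt.1 pt.2).
  exact: row_smoothD oT (row_smooth_omul oT u' w) (row_smooth_omul oT u w').
have sJu : row_smooth setT (fun pt : V * V => Ju pt.1 pt.2).
  apply: row_smoothD => //; last exact: row_smoothN (row_smoothZ oT sj u).
  apply: row_smoothD => //; first exact: row_smoothN (row_smoothZ oT sa v).
  exact: row_smoothN.
have sJv : row_smooth setT (fun pt : V * V => Jv pt.1 pt.2).
  apply: row_smoothD => //; last exact: row_smoothN (row_smoothZ oT sj v).
  exact: row_smoothD oT (row_smoothZ oT sa u) u'.
apply: smooth_pair => //; last first.
  apply: (row_smoothP oT).
  exact: row_smoothD oT (row_smooth_ocoord oT u sJv) (row_smooth_ocoord oT sJu v).
apply: smooth_pair => //; apply: (row_smoothP oT) => //.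
exact: row_smoothZ oT sj (row_smooth_rot oT e).
Qed.

Lemma almost_complex_J : almost_complex_structure (@sphere_prod R) (@octJ R).
Proof.
split.
- move=> p t Mp /tangent_of_tangent_space tt.
  by apply: tangent_space_of_tangent => //; exact: tangent_J.
- by move=> p a t t' _ _ _; exact: octJ_linear.
- exact: smooth_on_smooth openT _ smooth_J.
- by move=> p t Mp /tangent_of_tangent_space tt; exact: octJ_octJ.
Qed.

End AlmostComplex.

(** * The cone *)

Section MoreCalculus.
Variable R : realType.

Lemma open_pos (V : normedModType R) (U : set V) (f : V -> R) :
  open U -> smooth U f -> open (U `&` [set x | 0 < f x]).
Proof.
move=> oU sf; rewrite openE => x [Ux fx]; rewrite /interior.
have fc : f @ x --> f x := Ck_on_continuous (sf 0%N) Ux.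
have n1 : \forall y \near x, 0 < f y.
  have o0 : open_nbhs (f x) [set a : R | 0 < a] by split; [exact: open_gt|].
  exact: fc _ (open_nbhs_nbhs o0).
by apply: filterS2 (open_nbhs_nbhs (conj oU Ux)) n1 => y.
Qed.

Lemma smooth_expR_comp (V : normedModType R) (U : set V) (f : V -> R) :
  open U -> smooth U f -> smooth U (fun x => expR (f x)).
Proof. by move=> oU sf; exact: (smooth_comp oU (smooth_expR openT) (fun _ _ => Logic.I)). Qed.

Lemma continuous_linear_frame i j : continuous_linear (fun u : 'rV[R]_8 => frame u i j).
Proof.
split=> [a x y|x]; first by rewrite frameD frameZ !mxE.
have s1 : row_smooth setT (@id 'rV[R]_8) := row_smooth_linear setT (continuous_linear_id _).
exact: (Ck_on_continuous (smooth_frame i j openT s1 0%N) Logic.I).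
Qed.

Section Diff.
Variables (V : normedModType R) (x v : V).

Lemma diff_rowZ n (a : V -> R) (f : V -> 'rV[R]_n) :
  differentiable a x -> differentiable f x -> differentiable (fun y => a y *: f y) x ->
  'd (fun y => a y *: f y) x v = 'd a x v *: f x + a x *: 'd f x v.
Proof.
move=> da df daf; apply/rowP => j.
have C (h : V -> 'rV[R]_n) := @diff_linear_comp _ _ _ _ _ h x v (continuous_linear_coord R j).
have [_ <-] := C _ daf.
have -> : (fun y => (a y *: f y) 0 j) = (fun y => a y * f y 0 j).
  by apply/funext => y; rewrite mxE.
apply: (etrans (diffME v da (C _ df).1)); rewrite !mxE.
have E (b c d e e' : R) : e = e' -> b * e + c * d = d * c + b * e'.
  by move=> ->; rewrite addrC (mulrC c).
exact: E (C _ df).2.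
Qed.

Lemma diff_ocoord (f g : V -> 'rV[R]_8) :
  differentiable f x -> differentiable g x -> differentiable (fun y => ocoord (f y) (g y)) x ->
  'd (fun y => ocoord (f y) (g y)) x v =
  ocoord ('d f x v) (g x) + ocoord (f x) ('d g x v).
Proof.
move=> df dg dfg; apply/rowP => j.
have C n (h : V -> 'rV[R]_n) i := @diff_linear_comp _ _ _ _ _ h x v (continuous_linear_coord R i).
have F i := @diff_linear_comp _ _ _ _ _ f x v (continuous_linear_frame j i).
have [_ <-] := C _ _ j dfg.
have -> : (fun y => ocoord (f y) (g y) 0 j) = (fun y => \sum_i g y 0 i * frame (f y) j i).
  apply/funext => y; rewrite mxE; apply: eq_bigr => i _; by rewrite [in LHS]mxE.
apply: (etrans (diff_sumE v (fun i => differentiableM (C _ g i dg).1 (F i df).1)).2).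
rewrite !mxE -big_split; apply: eq_bigr => i _.
have T (m : 'rV[R]_8) : (frame m)^T i j = frame m j i by rewrite mxE.
rewrite !T.
apply: (etrans (diffME v (C _ g i dg).1 (F i df).1)).
have E (b c d d' e e' : R) : e = e' -> d = d' -> b * e + c * d = b * e' + d' * c.
  by move=> -> ->; rewrite (mulrC c).
exact: E (F i df).2 (C _ g i dg).2.
Qed.

End Diff.

End MoreCalculus.

(* For z = x + iy in the cone put a = z_0 + i eps z_(k+1) and b = z_0 - i eps z_(k+1),
   eps = 1 or -1: where a <> 0, the equation sum_j z_j^2 = 0 solves for b in
   terms of a and the six remaining coordinates. *)
Section Cone.
Variables (R : realType) (eps : R) (k : 'I_7).
Hypothesis eps2 : eps * eps = 1.
Local Notation X := ('rV[R]_7 * 'rV[R]_7)%type.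
Implicit Types z t : X.

Definition cone_a2 z : R := z.1 0 0 * z.1 0 0 + z.2 0 0 * z.2 0 0.

Definition cone_q1 z : R := \sum_(l < 6)
  (z.1 0 (lift 0 l) * z.1 0 (lift 0 l) - z.2 0 (lift 0 l) * z.2 0 (lift 0 l)).

Definition cone_q2 z : R :=
  \sum_(l < 6) (z.1 0 (lift 0 l) * z.2 0 (lift 0 l)) * 2.

(** The number b = - q / a in real terms, that is - q times the conjugate of a divided by
    [cone_a2 z] = |a|^2, where q = [cone_q1] + i [cone_q2] is the sum of the squares of the six
    remaining coordinates. *)
Definition cone_b1 z : R :=
  - (cone_q1 z * z.1 0 0 + cone_q2 z * z.2 0 0) * (cone_a2 z)^-1.

Definition cone_b2 z : R :=
  (cone_q1 z * z.2 0 0 - cone_q2 z * z.1 0 0) * (cone_a2 z)^-1.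

(** Real part of the point of the cone with given a: its coordinates 0 and k + 1 are (a + b) / 2 and
    - i eps (a - b) / 2, the latter because eps is its own inverse. *)
Definition cone_x z : 'rV[R]_8 := \row_j
  if unlift 0 j is Some j' then
    if unlift k j' is Some l then z.1 0 (lift 0 l)
    else (z.2 0 0 - cone_b2 z) * (eps / 2)
  else (z.1 0 0 + cone_b1 z) * 2^-1.

Definition cone_y z : 'rV[R]_8 := \row_j
  if unlift 0 j is Some j' then
    if unlift k j' is Some l then z.2 0 (lift 0 l)
    else (z.1 0 0 - cone_b1 z) * (- eps / 2)
  else (z.2 0 0 + cone_b2 z) * 2^-1.

Definition cone_dom : set X := [set z | 0 < cone_a2 z].

Lemma dot_lift (u v : 'rV[R]_8) : dot u v = u 0 0 * v 0 0 +
  u 0 (lift 0 k) * v 0 (lift 0 k) +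
  \sum_(l < 6) u 0 (lift 0 (lift k l)) * v 0 (lift 0 (lift k l)).
Proof. by rewrite /dot big_ord_recl (bigD1_ord k)//= addrA. Qed.

Lemma row_liftP (x y : 'rV[R]_8) : x 0 0 = y 0 0 ->
  x 0 (lift 0 k) = y 0 (lift 0 k) ->
  (forall l, x 0 (lift 0 (lift k l)) = y 0 (lift 0 (lift k l))) -> x = y.
Proof.
move=> e0 ek el; apply/rowP => j; case: (unliftP 0 j) => [j' ->|->//].
by case: (unliftP k j') => [l ->|->].
Qed.

Lemma cone_coordE z :
  [/\ cone_x z 0 0 = (z.1 0 0 + cone_b1 z) * 2^-1,
      cone_y z 0 0 = (z.2 0 0 + cone_b2 z) * 2^-1,
      cone_x z 0 (lift 0 k) = (z.2 0 0 - cone_b2 z) * (eps / 2),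
      cone_y z 0 (lift 0 k) = (z.1 0 0 - cone_b1 z) * (- eps / 2) &
      forall l, cone_x z 0 (lift 0 (lift k l)) = z.1 0 (lift 0 l) /\
                cone_y z 0 (lift 0 (lift k l)) = z.2 0 (lift 0 l)].
Proof.
by split=> [||||l]; rewrite !mxE ?unlift_none ?liftK ?unlift_none ?liftK.
Qed.

Lemma cone_ab z : cone_dom z ->
  z.1 0 0 * cone_b1 z - z.2 0 0 * cone_b2 z + cone_q1 z = 0 /\
  z.1 0 0 * cone_b2 z + z.2 0 0 * cone_b1 z + cone_q2 z = 0.
Proof.
rewrite /cone_dom /= /cone_b1 /cone_b2 => /lt0r_neq0; rewrite /cone_a2.
set a0 := z.1 0 0; set a1 := z.2 0 0 => D0.
by split; field; rewrite -!expr2 in D0 *.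
Qed.

Lemma cone_eq z : cone_dom z ->
  dot (cone_x z) (cone_x z) = dot (cone_y z) (cone_y z) /\
  dot (cone_y z) (cone_x z) = 0.
Proof.
move=> /cone_ab; have [x0 y0 xk yk xl] := cone_coordE z.
pose f (x y : 'rV[R]_7) : R := \sum_(l < 6) x 0 (lift 0 l) * y 0 (lift 0 l).
have S1 : \sum_(l < 6) cone_x z 0 (lift 0 (lift k l)) * cone_x z 0 (lift 0 (lift k l)) =
    f z.1 z.1 by apply: eq_bigr => l _; rewrite (xl l).1.
have S2 : \sum_(l < 6) cone_y z 0 (lift 0 (lift k l)) * cone_y z 0 (lift 0 (lift k l)) =
    f z.2 z.2 by apply: eq_bigr => l _; rewrite (xl l).2.
have S3 : \sum_(l < 6) cone_y z 0 (lift 0 (lift k l)) * cone_x z 0 (lift 0 (lift k l)) =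
    f z.1 z.2 by apply: eq_bigr => l _; rewrite (xl l).1 (xl l).2 mulrC.
rewrite !dot_lift x0 y0 xk yk S1 S2 S3.
rewrite /cone_q1 /cone_q2 sumrB -mulr_suml -/(f z.1 z.1) -/(f z.2 z.2) -/(f z.1 z.2).
set a0 := z.1 0 0; set a1 := z.2 0 0; set b0 := cone_b1 z; set b1 := cone_b2 z.
(* The square of eps is isolated so that [eps2] can remove it; linear arithmetic can then combine
   the result with the two parts of a b + q = 0. *)
have e1 a b : a * (eps / 2) * (b * (eps / 2)) = a * b * (eps * eps) / 4 by field.
have e2 a b : a * (- eps / 2) * (b * (- eps / 2)) = a * b * (eps * eps) / 4 by field.
have e3 a b : a * (- eps / 2) * (b * (eps / 2)) = - a * b * (eps * eps) / 4 by field.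
by rewrite e1 e2 e3 eps2 => -[h1 h2]; split; lra.
Qed.

Definition cone_proj (x y : 'rV[R]_8) : X :=
  (\row_j (if unlift 0 j is Some l then x 0 (lift 0 (lift k l))
           else x 0 0 - eps * y 0 (lift 0 k)),
   \row_j (if unlift 0 j is Some l then y 0 (lift 0 (lift k l))
           else y 0 0 + eps * x 0 (lift 0 k))).

Lemma cone_projE x y :
  [/\ (cone_proj x y).1 0 0 = x 0 0 - eps * y 0 (lift 0 k),
      (cone_proj x y).2 0 0 = y 0 0 + eps * x 0 (lift 0 k) &
      forall l, (cone_proj x y).1 0 (lift 0 l) = x 0 (lift 0 (lift k l)) /\
                (cone_proj x y).2 0 (lift 0 l) = y 0 (lift 0 (lift k l))].
Proof. by split=> [||l]; rewrite !mxE ?unlift_none ?liftK. Qed.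

(** For a point of the cone, z_0 - i eps z_(k+1) solves the same linear equation as b; since a is
    nonzero the two coincide, and the remaining coordinates are copied unchanged. *)
Lemma cone_xyK x y : dot x x = dot y y -> dot y x = 0 ->
  cone_dom (cone_proj x y) ->
  cone_x (cone_proj x y) = x /\ cone_y (cone_proj x y) = y.
Proof.
move=> xx xy; set z := cone_proj x y => zD.
have [z1 z2 zl] := cone_projE x y; have [x0 y0 xk yk xl] := cone_coordE z.
pose f (x y : 'rV[R]_8) : R :=
  \sum_(l < 6) x 0 (lift 0 (lift k l)) * y 0 (lift 0 (lift k l)).
have q1E : cone_q1 z = f x x - f y y.
  by rewrite /cone_q1 sumrB; congr (_ - _); apply: eq_bigr => l _;
    rewrite ?(zl l).1 ?(zl l).2.
have q2E : cone_q2 z = f y x * 2.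
  rewrite /cone_q2 -mulr_suml; congr (_ * _); apply: eq_bigr => l _.
  by rewrite (zl l).1 (zl l).2 mulrC.
move: xx xy; rewrite !dot_lift -/(f x x) -/(f y y) -/(f y x) => xx xy.
have [e1 e2] := cone_ab zD; move: e1 e2 (zD); rewrite /cone_dom /= /cone_a2 q1E q2E z1 z2.
move: x0 y0 xk yk; rewrite z1 z2.
set b1 := cone_b1 z; set b2 := cone_b2 z.
move: xx xy; set F := f x x; set G := f y y; set H := f y x.
set p := x 0 0; set q := y 0 0; set r := x 0 (lift 0 k); set s := y 0 (lift 0 k).
move=> xx xy x0 y0 xk yk h1 h2 D0.
have D0' := lt0r_neq0 D0.
(* [g1] and [g2] say that a kills the difference of the two candidates for b; multiplying by the
   conjugate of a leaves |a|^2 times that difference. *)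
have [B1 B2] : b1 = p + eps * s /\ b2 = q - eps * r.
  have g1 : (p - eps * s) * (b1 - (p + eps * s)) - (q + eps * r) * (b2 - (q - eps * r)) = 0.
    transitivity ((p - eps * s) * b1 - (q + eps * r) * b2 + (F - G) -
      (p * p + r * r * (eps * eps) + F - (q * q + s * s * (eps * eps) + G))); first by ring.
    by rewrite h1 eps2; lra.
  have g2 : (p - eps * s) * (b2 - (q - eps * r)) + (q + eps * r) * (b1 - (p + eps * s)) = 0.
    transitivity ((p - eps * s) * b2 + (q + eps * r) * b1 + H * 2 -
      2 * (q * p + s * r * (eps * eps) + H)); first by ring.
    by rewrite h2 eps2; lra.
  move: g1 g2 D0'; set c1 := b1 - _; set c2 := b2 - _.
  set a1 := p - _; set a2 := q + _ => g1 g2 D0'.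
  have c10 : (a1 * a1 + a2 * a2) * c1 = 0.
    by transitivity (a1 * (a1 * c1 - a2 * c2) + a2 * (a1 * c2 + a2 * c1));
      [ring|rewrite g1 g2; ring].
  have c20 : (a1 * a1 + a2 * a2) * c2 = 0.
    by transitivity (a1 * (a1 * c2 + a2 * c1) - a2 * (a1 * c1 - a2 * c2));
      [ring|rewrite g1 g2; ring].
  split; apply/eqP; rewrite -subr_eq0; apply/eqP/(mulfI D0'); rewrite mulr0.
    exact: c10.
  exact: c20.
split; apply: row_liftP => [||l]; rewrite ?x0 ?y0 ?xk ?yk ?B1 ?B2.
- by rewrite -/p; field.
- transitivity (eps * eps * r); first by field.
  by rewrite eps2 mul1r.
- by rewrite (xl l).1 (zl l).1.
- by rewrite -/q; field.
- transitivity (eps * eps * s); first by field.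
  by rewrite eps2 mul1r.
by rewrite (xl l).2 (zl l).2.
Qed.

Lemma smooth_cone :
  [/\ open cone_dom, row_smooth cone_dom cone_x, row_smooth cone_dom cone_y &
      smooth cone_dom cone_b1 /\ smooth cone_dom cone_b2].
Proof.
have L1 j U : smooth U (fun z : X => z.1 0 j).
  exact: (row_smooth_linear U (continuous_linear_fst _ _)).
have L2 j U : smooth U (fun z : X => z.2 0 j).
  exact: (row_smooth_linear U (continuous_linear_snd _ _)).
have M1 (U : set X) (f g : X -> R) : open U -> smooth U f -> smooth U g -> smooth U (fun z => f z * g z).
  exact: smoothM.
have oT : open [set: X] by exact: openT.
have sD : smooth setT cone_a2 by apply: (smoothD oT); exact: (M1 _ _ _ oT).
have oD : open cone_dom.
  by have := open_pos oT sD; rewrite setTI.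
have sDi : smooth cone_dom (fun z => (cone_a2 z)^-1).
  apply: (smooth_comp oD (@smooth_inv R)) => [z|]; first exact: lt0r_neq0.
  exact: smooth_sub sD.
have sq1 : smooth cone_dom cone_q1.
  apply: (@smooth_sum _ _ _ _ _ (fun (l : 'I_6) z => z.1 0 (lift 0 l) * z.1 0 (lift 0 l) -
    z.2 0 (lift 0 l) * z.2 0 (lift 0 l)) oD) => l.
  by apply: (smoothB oD); exact: (M1 _ _ _ oD).
have sq2 : smooth cone_dom cone_q2.
  apply: (@smooth_sum _ _ _ _ _ (fun (l : 'I_6) z => (z.1 0 (lift 0 l) * z.2 0 (lift 0 l)) * 2) oD) => l.
  by apply: (smoothM oD); [exact: (M1 _ _ _ oD)|exact: smooth_cst].
have sb1 : smooth cone_dom cone_b1.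
  apply: (smoothM oD) => //; apply: (smoothN oD); apply: (smoothD oD); exact: (M1 _ _ _ oD).
have sb2 : smooth cone_dom cone_b2.
  apply: (smoothM oD) => //; apply: (smoothB oD); exact: (M1 _ _ _ oD).
split=> // j.
- apply: (smooth_eq (f := fun z => if unlift 0 j is Some j' then
    if unlift k j' is Some l then z.1 0 (lift 0 l)
    else (z.2 0 0 - cone_b2 z) * (eps / 2)
  else (z.1 0 0 + cone_b1 z) * 2^-1) oD) => [z _|]; first by rewrite mxE.
  case: (unlift 0 j) => [j'|].
    case: (unlift k j') => [l|]; first exact: L1.
    by apply: (smoothM oD); [exact: smoothB|exact: smooth_cst].
  by apply: (smoothM oD); [exact: smoothD|exact: smooth_cst].
- apply: (smooth_eq (f := fun z => if unlift 0 j is Some j' then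
    if unlift k j' is Some l then z.2 0 (lift 0 l)
    else (z.1 0 0 - cone_b1 z) * (- eps / 2)
  else (z.2 0 0 + cone_b2 z) * 2^-1) oD) => [z _|]; first by rewrite mxE.
  case: (unlift 0 j) => [j'|].
    case: (unlift k j') => [l|]; first exact: L2.
    by apply: (smoothM oD); [exact: smoothB|exact: smooth_cst].
  by apply: (smoothM oD); [exact: smoothD|exact: smooth_cst].
Qed.

(** The first two equations are the real and imaginary parts of a b' + c s + k = 0, the last two
    those of the same equation with i s and i k in place of s and k. As a is nonzero, its solution
    is i times the former one. *)
Lemma cauchy_riemann_solve (a1 a2 s1 s2 c1 c2 k1 k2 b1 b2 b1' b2' : R) :
  a1 * a1 + a2 * a2 != 0 ->
  a1 * b1 + c1 * s1 - (a2 * b2 + c2 * s2) + k1 = 0 ->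
  a1 * b2 + c2 * s1 + (a2 * b1 + c1 * s2) + k2 = 0 ->
  a1 * b1' + c1 * - s2 - (a2 * b2' + c2 * s1) + - k2 = 0 ->
  a1 * b2' + c2 * - s2 + (a2 * b1' + c1 * s1) + k1 = 0 ->
  b1' = - b2 /\ b2' = b1.
Proof.
move=> D0 h1 h2 h3 h4.
have g1 : a1 * (b1' + b2) - a2 * (b2' - b1) = 0 by lra.
have g2 : a1 * (b2' - b1) + a2 * (b1' + b2) = 0 by lra.
have e1 : (a1 * a1 + a2 * a2) * (b1' + b2) = 0.
  by transitivity (a1 * (a1 * (b1' + b2) - a2 * (b2' - b1)) + a2 * (a1 * (b2' - b1) + a2 * (b1' + b2)));
    [ring|rewrite g1 g2; ring].
have e2 : (a1 * a1 + a2 * a2) * (b2' - b1) = 0.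
  by transitivity (a1 * (a1 * (b2' - b1) + a2 * (b1' + b2)) - a2 * (a1 * (b1' + b2) - a2 * (b2' - b1)));
    [ring|rewrite g1 g2; ring].
split; apply/eqP.
  by rewrite -addr_eq0; apply/eqP/(mulfI D0); rewrite mulr0.
by rewrite -subr_eq0; apply/eqP/(mulfI D0); rewrite mulr0.
Qed.

Lemma cauchy_riemann_cone (dX dY : X -> 'rV[R]_8) (B1 B2 : X -> R) t :
  [/\ forall s, (dX s) 0 0 = (s.1 0 0 + B1 s) * 2^-1,
    forall s, (dY s) 0 0 = (s.2 0 0 + B2 s) * 2^-1,
    forall s, (dX s) 0 (lift 0 k) = (s.2 0 0 - B2 s) * (eps / 2),
    forall s, (dY s) 0 (lift 0 k) = (s.1 0 0 - B1 s) * (- eps / 2) &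
    forall l s, (dX s) 0 (lift 0 (lift k l)) = s.1 0 (lift 0 l) /\
      (dY s) 0 (lift 0 (lift k l)) = s.2 0 (lift 0 l)] ->
  B1 (realify_i t) = - B2 t -> B2 (realify_i t) = B1 t ->
  dX (realify_i t) = - dY t /\ dY (realify_i t) = dX t.
Proof.
move=> [x0 y0 xk yk xl] h1 h2.
have t1 j : (realify_i t).1 0 j = - t.2 0 j by rewrite mxE.
have t2 j : (realify_i t).2 0 j = t.1 0 j by [].
have N (m : 'rV[R]_8) j : (- m) 0 j = - m 0 j by rewrite mxE.
split; apply: row_liftP => [||l]; rewrite ?N.
- by rewrite x0 y0 h1 t1; ring.
- by rewrite xk yk h2 t2; ring.
- by rewrite (xl _ _).1 (xl _ _).2 t1.
- by rewrite x0 y0 h2 t2.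
- by rewrite xk yk h1 t1; ring.
by rewrite (xl _ _).1 (xl _ _).2 t2.
Qed.

Section ConeDiff.
Variable z : X.
Hypothesis zD : cone_dom z.

Let oD : open cone_dom. Proof. by case: smooth_cone. Qed.

Let coord1 j t : differentiable (fun z : X => z.1 0 j) z /\
  'd (fun z : X => z.1 0 j) z t = t.1 0 j.
Proof.
apply: diff_continuous_linear.
exact: continuous_linear_comp (continuous_linear_fst _ _) (continuous_linear_coord R j).
Qed.

Let coord2 j t : differentiable (fun z : X => z.2 0 j) z /\
  'd (fun z : X => z.2 0 j) z t = t.2 0 j.
Proof.
apply: diff_continuous_linear.
exact: continuous_linear_comp (continuous_linear_snd _ _) (continuous_linear_coord R j).
Qed.

Let diff_prod (f g : X -> R) t (a b : R) :
  differentiable f z /\ 'd f z t = a -> differentiable g z /\ 'd g z t = b ->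
  differentiable (fun y => f y * g y) z /\
  'd (fun y => f y * g y) z t = f z * b + g z * a.
Proof.
by move=> [df <-] [dg <-]; split; [exact: differentiableM|exact: diffME].
Qed.

Let diff_add (f g : X -> R) t (a b : R) :
  differentiable f z /\ 'd f z t = a -> differentiable g z /\ 'd g z t = b ->
  differentiable (fun y => f y + g y) z /\ 'd (fun y => f y + g y) z t = a + b.
Proof.
by move=> [df <-] [dg <-]; split; [exact: differentiableD|exact: diffDE].
Qed.

Let diff_sub (f g : X -> R) t (a b : R) :
  differentiable f z /\ 'd f z t = a -> differentiable g z /\ 'd g z t = b ->
  differentiable (fun y => f y - g y) z /\ 'd (fun y => f y - g y) z t = a - b.
Proof.
by move=> [df <-] [dg <-]; split; [exact: differentiableB|exact: diffBE].
Qed.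

Let diff_mulc (f : X -> R) t (a c : R) : differentiable f z /\ 'd f z t = a ->
  differentiable (fun y => f y * c) z /\ 'd (fun y => f y * c) z t = a * c.
Proof.
by move=> [df <-]; split; [exact: differentiableZl|exact: diffZlE].
Qed.

Let diff_sum6 (f : 'I_6 -> X -> R) t (a : 'I_6 -> R) :
  (forall l, differentiable (f l) z /\ 'd (f l) z t = a l) ->
  differentiable (fun y => \sum_l f l y) z /\ 'd (fun y => \sum_l f l y) z t = \sum_l a l.
Proof.
move=> fa; have [d1 d2] := diff_sumE t (fun l => (fa l).1).
by split=> //; apply: (etrans d2); apply: eq_bigr => l _; exact: (fa l).2.
Qed.

Let dq1 t : differentiable cone_q1 z /\ 'd cone_q1 z t =
  \sum_(l < 6) (z.1 0 (lift 0 l) * t.1 0 (lift 0 l) + z.1 0 (lift 0 l) * t.1 0 (lift 0 l) -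
    (z.2 0 (lift 0 l) * t.2 0 (lift 0 l) + z.2 0 (lift 0 l) * t.2 0 (lift 0 l))).
Proof.
apply: (diff_sum6 (f := fun l z => z.1 0 (lift 0 l) * z.1 0 (lift 0 l) -
  z.2 0 (lift 0 l) * z.2 0 (lift 0 l))) => l.
by apply: diff_sub; apply: diff_prod.
Qed.

Let dq2 t : differentiable cone_q2 z /\ 'd cone_q2 z t =
  \sum_(l < 6) (z.1 0 (lift 0 l) * t.2 0 (lift 0 l) + z.2 0 (lift 0 l) * t.1 0 (lift 0 l)) * 2.
Proof.
apply: (diff_sum6 (f := fun l z => z.1 0 (lift 0 l) * z.2 0 (lift 0 l) * 2)) => l.
by apply: diff_mulc; apply: diff_prod.
Qed.

Let db1 t : differentiable cone_b1 z /\ 'd cone_b1 z t = 'd cone_b1 z t.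
Proof. by split=> //; case: smooth_cone => _ _ _ [s _]; exact: smooth_differentiable s zD. Qed.

Let db2 t : differentiable cone_b2 z /\ 'd cone_b2 z t = 'd cone_b2 z t.
Proof. by split=> //; case: smooth_cone => _ _ _ [_ s]; exact: smooth_differentiable s zD. Qed.

Let zero_near (f : X -> R) t (a : R) : (forall y, cone_dom y -> f y = 0) ->
  differentiable f z /\ 'd f z t = a -> a = 0.
Proof.
move=> f0 [df <-].
have n0 : \forall y \near z, cst 0 y = f y.
  by apply: filterS (open_nbhs_nbhs (conj oD zD)) => y /f0 ->.
by apply: etrans (near_eq_diffE _ n0 (differentiable_cst _ _)) _; exact: diff_cstE.
Qed.

(** Implicit differentiation of a b + q = 0 instead of the quotient rule: in the direction i t, the
    derivatives of a and q are i times those in the direction t, so the same is true of b. *)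
Lemma diff_cone_b t : 'd cone_b1 z (realify_i t) = - 'd cone_b2 z t /\
  'd cone_b2 z (realify_i t) = 'd cone_b1 z t.
Proof.
have E1 s := zero_near (fun y yD => (cone_ab yD).1)
  (diff_add (diff_sub (diff_prod (coord1 0 s) (db1 s)) (diff_prod (coord2 0 s) (db2 s))) (dq1 s)).
have E2 s := zero_near (fun y yD => (cone_ab yD).2)
  (diff_add (diff_add (diff_prod (coord1 0 s) (db2 s)) (diff_prod (coord2 0 s) (db1 s))) (dq2 s)).
pose t' := realify_i t.
have q1E : \sum_(l < 6) (z.1 0 (lift 0 l) * t'.1 0 (lift 0 l) + z.1 0 (lift 0 l) * t'.1 0 (lift 0 l) -
    (z.2 0 (lift 0 l) * t'.2 0 (lift 0 l) + z.2 0 (lift 0 l) * t'.2 0 (lift 0 l))) =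
  - \sum_(l < 6) (z.1 0 (lift 0 l) * t.2 0 (lift 0 l) + z.2 0 (lift 0 l) * t.1 0 (lift 0 l)) * 2.
  by rewrite -sumrN; apply: eq_bigr => l _; rewrite /t' !mxE /=; ring.
have q2E : \sum_(l < 6) (z.1 0 (lift 0 l) * t'.2 0 (lift 0 l) + z.2 0 (lift 0 l) * t'.1 0 (lift 0 l)) * 2 =
  \sum_(l < 6) (z.1 0 (lift 0 l) * t.1 0 (lift 0 l) + z.1 0 (lift 0 l) * t.1 0 (lift 0 l) -
    (z.2 0 (lift 0 l) * t.2 0 (lift 0 l) + z.2 0 (lift 0 l) * t.2 0 (lift 0 l))).
  by apply: eq_bigr => l _; rewrite /t' !mxE /=; ring.
have t1 : t'.1 0 0 = - t.2 0 0 by rewrite mxE.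
have h3 := E1 t'; rewrite q1E t1 in h3.
have h4 := E2 t'; rewrite q2E t1 in h4.
exact: cauchy_riemann_solve (lt0r_neq0 zD) (E1 t) (E2 t) h3 h4.
Qed.

Lemma diff_cone t : 'd cone_x z (realify_i t) = - 'd cone_y z t /\
  'd cone_y z (realify_i t) = 'd cone_x z t.
Proof.
have [_ sx sy _] := smooth_cone.
have dx := smooth_differentiable (row_smoothP oD sx) zD.
have dy := smooth_differentiable (row_smoothP oD sy) zD.
have C (f : X -> 'rV[R]_8) (df : differentiable f z) j s :=
  (@diff_linear_comp _ _ _ _ _ f z s (continuous_linear_coord R j) df).2.
have [x0 y0 xk yk xl] : [/\ forall s, ('d cone_x z s) 0 0 = (s.1 0 0 + 'd cone_b1 z s) * 2^-1,
    forall s, ('d cone_y z s) 0 0 = (s.2 0 0 + 'd cone_b2 z s) * 2^-1,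
    forall s, ('d cone_x z s) 0 (lift 0 k) = (s.2 0 0 - 'd cone_b2 z s) * (eps / 2),
    forall s, ('d cone_y z s) 0 (lift 0 k) = (s.1 0 0 - 'd cone_b1 z s) * (- eps / 2) &
    forall l s, ('d cone_x z s) 0 (lift 0 (lift k l)) = s.1 0 (lift 0 l) /\
      ('d cone_y z s) 0 (lift 0 (lift k l)) = s.2 0 (lift 0 l)].
  have F (f : X -> 'rV[R]_8) j (g : X -> R) s a : differentiable f z -> (forall y, f y 0 j = g y) ->
      differentiable g z /\ 'd g z s = a -> ('d f z s) 0 j = a :> R.
    move=> df fg [_ <-]; rewrite -(C f df j s); congr ('d _ _ _).
    by apply/funext => y; rewrite fg.
  split=> [s|s|s|s|l s].
  - apply: (F _ _ _ _ _ dx) => [y|]; first by case: (cone_coordE y) => -> _ _ _ _.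
    exact: diff_mulc (diff_add (coord1 0 s) (db1 s)).
  - apply: (F _ _ _ _ _ dy) => [y|]; first by case: (cone_coordE y) => _ -> _ _ _.
    exact: diff_mulc (diff_add (coord2 0 s) (db2 s)).
  - apply: (F _ _ _ _ _ dx) => [y|]; first by case: (cone_coordE y) => _ _ -> _ _.
    exact: diff_mulc (diff_sub (coord2 0 s) (db2 s)).
  - apply: (F _ _ _ _ _ dy) => [y|]; first by case: (cone_coordE y) => _ _ _ -> _.
    exact: diff_mulc (diff_sub (coord1 0 s) (db1 s)).
  - split.
      apply: (F _ _ _ _ _ dx) => [y|]; first by case: (cone_coordE y) => _ _ _ _ /(_ l)[-> _].
      exact: coord1.
    apply: (F _ _ _ _ _ dy) => [y|]; first by case: (cone_coordE y) => _ _ _ _ /(_ l)[_ ->].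
    exact: coord2.
have [h1 h2] := diff_cone_b t.
exact: (cauchy_riemann_cone (And5 x0 y0 xk yk xl) h1 h2).
Qed.

End ConeDiff.

End Cone.

(** * Charts *)

Lemma cos_sin_atan (R : realType) (a b : R) : 0 < b -> a * a + b * b = 1 ->
  cos (atan (a / b)) = b /\ sin (atan (a / b)) = a.
Proof.
move=> b0 ab; have bn0 := lt0r_neq0 b0.
have c : cos (atan (a / b)) = b.
  rewrite cos_atan; have -> : 1 + (a / b) ^+ 2 = b ^- 2.
    have -> : 1 + (a / b) ^+ 2 = (a * a + b * b) * b ^- 2 by field.
    by rewrite ab mul1r.
  by rewrite sqrtrV ?sqr_ge0// sqrtr_sqr invrK gtr0_norm.
split=> //; have := atanK (a / b); rewrite /tan c => /(congr1 ( *%R^~ b)).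
by rewrite !divfK.
Qed.

Section Chart.
Variables (R : realType) (al eps : R) (k : 'I_7).
Hypothesis eps2 : eps * eps = 1.
Local Notation V := ('rV[R]_2 * 'rV[R]_8 * 'rV[R]_7)%type.
Local Notation X := ('rV[R]_7 * 'rV[R]_7)%type.
Local Notation cx := (cone_x eps k).
Local Notation cy := (cone_y eps k).
Implicit Types (p : V) (z : X).

Definition circle (t : R) : 'rV[R]_2 := \row_j (if j == 0 then cos t else sin t).

(** The t of z = e^t (u + i v): the real part of z has length e^t, hence the half of the logarithm
    of its square. *)
Definition log_radius z : R := ln (dot (cx z) (cx z)) * 2^-1.

Definition cone_point z : V :=
  (circle (log_radius z), expR (- log_radius z) *: cx z,
   ocoord (expR (- log_radius z) *: cx z) (expR (- log_radius z) *: cy z)).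

(** The last two conditions keep t within pi / 2 of [al], which singles out one determination of the
    angle. *)
Definition cone_point_dom : set X :=
  cone_dom (R := R) `&` [set z | 0 < dot (cx z) (cx z)] `&`
    [set z | 0 < log_radius z - al + pi / 2] `&`
    [set z | 0 < pi / 2 - (log_radius z - al)].

Lemma smooth_cone_point : [/\ open cone_point_dom, smooth cone_point_dom cone_point &
  smooth cone_point_dom (fun z => expR (- log_radius z) *: cy z)].
Proof.
have [oD sx sy _] := smooth_cone eps k.
have oN := open_pos oD (smooth_dot oD sx sx).
set U := _ `&` _ in oN.
have UD : U `<=` cone_dom (R := R) by move=> z [].
have sN : smooth U (fun z => dot (cx z) (cx z)) := smooth_sub UD (smooth_dot oD sx sx).
have sln : smooth U (fun z => ln (dot (cx z) (cx z))).
  by apply: (smooth_comp oN (@smooth_ln R)) sN => z [].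
have sL : smooth U log_radius := smoothM oN sln (smooth_cst _ _).
have sLa : smooth U (fun z => log_radius z - al) := smoothB oN sL (smooth_cst _ _).
have o1 := open_pos oN (smoothD oN sLa (smooth_cst U (pi / 2))).
have o2 : open cone_point_dom.
  apply: (open_pos o1); apply: smooth_sub (smoothB oN (smooth_cst U (pi / 2)) sLa).
  by move=> z [].
have PU : cone_point_dom `<=` U by move=> z [[]].
have rs n (f : X -> 'rV[R]_n) : row_smooth (cone_dom (R := R)) f -> row_smooth cone_point_dom f.
  by move=> sf j; apply: smooth_sub (sf j) => z /PU/UD.
have sL' := smooth_sub PU sL.
have sE := smooth_expR_comp o2 (smoothN o2 sL').
have su := row_smoothZ o2 sE (rs _ _ sx).
have sv := row_smoothZ o2 sE (rs _ _ sy).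
split; [exact: o2| |exact: row_smoothP o2 sv].
apply: (smooth_pair o2); last exact: (row_smoothP o2 (row_smooth_ocoord o2 su sv)).
apply: (smooth_pair o2); last exact: (row_smoothP o2 su).
apply: (row_smoothP o2) => j.
have [ss sc] := smooth_sin_cos (R := R) openT.
have [j0|j1] := eqVneq j 0.
  apply: (smooth_eq o2 _ (smooth_comp o2 sc (fun _ _ => Logic.I) sL')) => z _.
  by rewrite mxE j0.
apply: (smooth_eq o2 _ (smooth_comp o2 ss (fun _ _ => Logic.I) sL')) => z _.
by rewrite mxE (negPf j1).
Qed.

(** Together with [sin_part], the cosine and sine of the angle measured from [al]. On the half
    circle where the cosine is positive, the arctangent of their quotient recovers that angle
    smoothly. *)
Definition cos_part p : R := p.1.1 0 0 * cos al + p.1.1 0 1 * sin al.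
Definition sin_part p : R := p.1.1 0 1 * cos al - p.1.1 0 0 * sin al.
Definition lift_angle p : R := al + atan (sin_part p / cos_part p).
Definition unit_coords p : X := cone_proj eps k p.1.2 (omul p.1.2 p.2).
Definition cone_coords p : X :=
  (expR (lift_angle p) *: (unit_coords p).1, expR (lift_angle p) *: (unit_coords p).2).

Definition cone_coords_dom : set V :=
  [set p | 0 < cos_part p] `&` [set p | 0 < cone_a2 (unit_coords p)].

Lemma smooth_cone_coords : open cone_coords_dom /\ smooth cone_coords_dom cone_coords.
Proof.
have oT : open [set: V] by exact: openT.
have e := row_smooth_linear setT (continuous_linear_circle R).
have u := row_smooth_linear setT (continuous_linear_sphere7 R).
have w := row_smooth_linear setT (continuous_linear_sphere6 R).
have v := row_smooth_omul oT u w.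
have M1 (f : V -> R) c : smooth setT f -> smooth setT (fun p => f p * c).
  by move=> sf; exact: smoothM oT sf (smooth_cst _ _).
have M2 (f : V -> R) c : smooth setT f -> smooth setT (fun p => c * f p).
  by move=> sf; exact: smoothM oT (smooth_cst _ _) sf.
have sc : smooth setT cos_part := smoothD oT (M1 _ _ (e 0)) (M1 _ _ (e 1)).
have ss : smooth setT sin_part := smoothB oT (M1 _ _ (e 1)) (M1 _ _ (e 0)).
have s1 : row_smooth setT (fun p => (unit_coords p).1).
  move=> j; apply: (smooth_eq (f := fun p => if unlift 0 j is Some l then
    p.1.2 0 (lift 0 (lift k l)) else p.1.2 0 0 - eps * omul p.1.2 p.2 0 (lift 0 k)) oT) => [p _|].
    by rewrite [in RHS]mxE.
  by case: (unlift 0 j) => [l|]; [exact: u|exact: smoothB oT (u 0) (M2 _ _ (v _))].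
have s2 : row_smooth setT (fun p => (unit_coords p).2).
  move=> j; apply: (smooth_eq (f := fun p => if unlift 0 j is Some l then
    omul p.1.2 p.2 0 (lift 0 (lift k l)) else omul p.1.2 p.2 0 0 + eps * p.1.2 0 (lift 0 k)) oT)
    => [p _|]; first by rewrite [in RHS]mxE.
  by case: (unlift 0 j) => [l|]; [exact: v|exact: smoothD oT (v 0) (M2 _ _ (u _))].
have sa : smooth setT (fun p => cone_a2 (unit_coords p)).
  exact: smoothD oT (smoothM oT (s1 0) (s1 0)) (smoothM oT (s2 0) (s2 0)).
have o1 : open [set p | 0 < cos_part p] by have := open_pos oT sc; rewrite setTI.
have oU : open cone_coords_dom by apply: (open_pos o1); exact: smooth_sub sa.
split=> //.
have sub (f : V -> R) : smooth setT f -> smooth cone_coords_dom f by exact: smooth_sub.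
have sq : smooth cone_coords_dom (fun p => sin_part p / cos_part p).
  apply: (smoothM oU (sub _ ss)).
  apply: (smooth_comp oU (@smooth_inv R)) (sub _ sc) => p [c0 _]; exact: lt0r_neq0.
have st : smooth cone_coords_dom lift_angle.
  apply: (smoothD oU (smooth_cst _ _)).
  exact: (smooth_comp oU (@smooth_atan R) (fun _ _ => Logic.I) sq).
have sE := smooth_expR_comp oU st.
by apply: (smooth_pair oU); apply: (row_smoothP oU); apply: (row_smoothZ oU sE) => j;
  apply: sub.
Qed.

Section Inverse.
Variable z : X.
Hypothesis zU : cone_point_dom z.
Local Notation L := (log_radius z).
Local Notation E := (expR (- L)).
Local Notation u := (E *: cx z).
Local Notation v := (E *: cy z).

Let zD : cone_dom z. Proof. by case: zU => -[[]]. Qed.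

Lemma exp_log_radius : E * E * dot (cx z) (cx z) = 1.
Proof.
case: zU => -[[_ N0] _] _.
rewrite -expRD -[X in _ * X](lnK N0) -expRD.
have -> : - L - L + ln (dot (cx z) (cx z)) = 0 by rewrite /log_radius; field.
exact: expR0.
Qed.

Let uu : dot u u = 1.
Proof. by rewrite dotZl dotZr mulrA exp_log_radius. Qed.
Let vv : dot v v = 1.
Proof. by rewrite dotZl dotZr mulrA -(cone_eq k eps2 zD).1 exp_log_radius. Qed.
Let vu : dot v u = 0.
Proof. by rewrite dotZl dotZr (cone_eq k eps2 zD).2 !mulr0. Qed.

Lemma omul_cone_point : omul u (ocoord u v) = v.
Proof. by rewrite omulK uu vu scale1r scale0r subr0. Qed.

Lemma cone_point_M : sphere_prod (cone_point z).
Proof.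
split; [split|]; apply/sphereE => //=.
  by rewrite dot2E !mxE /= -!expr2 cos2Dsin2.
by rewrite dot_ocoord omul_cone_point vv.
Qed.

Let unit_coordsE : unit_coords (cone_point z) = (E *: z.1, E *: z.2).
Proof.
rewrite /unit_coords /= omul_cone_point; have [x0 y0 xk yk xl] := cone_coordE eps k z.
have [p1 p2 pl] := cone_projE eps k u v.
have S (m : 'rV[R]_8) j : (E *: m) 0 j = E * m 0 j by rewrite mxE.
have S7 (m : 'rV[R]_7) j : (E *: m) 0 j = E * m 0 j by rewrite mxE.
congr (_, _); apply/rowP => j; rewrite S7; case: (unliftP 0 j) => [l ->|->].
- by rewrite (pl l).1 S (xl l).1.
- rewrite p1 !S x0 yk.
  (* The sign eps occurs once in the chart and once in its inverse; their product is displayed so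
     that [eps2] applies. *)
  transitivity (E * ((z.1 0 0 + cone_b1 z) * 2^-1 + (z.1 0 0 - cone_b1 z) * (eps * eps) / 2)).
    by field.
  by rewrite eps2; field.
- by rewrite (pl l).2 S (xl l).2.
- rewrite p2 !S y0 xk.
  transitivity (E * ((z.2 0 0 + cone_b2 z) * 2^-1 + (z.2 0 0 - cone_b2 z) * (eps * eps) / 2)).
    by field.
  by rewrite eps2; field.
Qed.

Let cosE : cos_part (cone_point z) = cos (L - al).
Proof. by rewrite /cos_part /= !mxE /= cosB. Qed.

Let sinE : sin_part (cone_point z) = sin (L - al).
Proof. by rewrite /sin_part /= !mxE /= sinB. Qed.

Let range : - (pi / 2) < L - al < pi / 2.
Proof. by case: zU => -[_ /= h1] /= h2; apply/andP; split; lra. Qed.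

Lemma cone_point_coords_dom : cone_coords_dom (cone_point z).
Proof.
split; first by rewrite /= cosE cos_gt0_pihalf.
rewrite /= unit_coordsE /cone_a2 /= !mxE.
have -> : forall a b c : R, a * b * (a * b) + a * c * (a * c) = a * a * (b * b + c * c).
  by move=> *; ring.
by rewrite !mulr_gt0// expR_gt0.
Qed.

Lemma cone_pointK : cone_coords (cone_point z) = z.
Proof.
(* [range] places L - al in the interval where the arctangent inverts the tangent. *)
have tL : lift_angle (cone_point z) = L.
  rewrite /lift_angle cosE sinE -/(tan _) tanK ?in_itv//; ring.
rewrite /cone_coords tL unit_coordsE /= !scalerA -expRD subrr expR0 !scale1r.
by case: (z).
Qed.

End Inverse.

Section Coords.
Variable p : V.
Hypotheses (Mp : sphere_prod p) (pO : cone_coords_dom p).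
Local Notation u := p.1.2.
Local Notation v := (omul p.1.2 p.2).
Local Notation r := (expR (lift_angle p)).

Let ee : dot p.1.1 p.1.1 = 1. Proof. by case: Mp => -[/sphereE]. Qed.
Let uu : dot u u = 1. Proof. by case: Mp => -[_ /sphereE]. Qed.
Let ww : dot p.2 p.2 = 1. Proof. by case: Mp => _ /sphereE. Qed.
Let vv : dot v v = 1. Proof. by rewrite dot_omul uu ww mulr1. Qed.

Let cone_coordsE : cone_coords p = cone_proj eps k (r *: u) (r *: v).
Proof.
rewrite /cone_coords /unit_coords; congr (_, _); apply/rowP => j; rewrite !mxE;
  by case: (unlift 0 j) => [l|]; rewrite ?mxE//; ring.
Qed.

Let cone_dom_coords : cone_dom (cone_coords p).
Proof.
have S (m : 'rV[R]_7) j : (r *: m) 0 j = r * m 0 j by rewrite mxE.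
rewrite /cone_dom /cone_a2 /cone_coords /= !S.
have -> : forall a b c : R, a * b * (a * b) + a * c * (a * c) = a * a * (b * b + c * c).
  by move=> *; ring.
by rewrite !mulr_gt0 ?expR_gt0//; case: pO.
Qed.

Let cxyE : cx (cone_coords p) = r *: u /\ cy (cone_coords p) = r *: v.
Proof.
have := cone_dom_coords; rewrite cone_coordsE => D; apply: (cone_xyK eps2 _ _ D).
  by rewrite !dot_lin uu vv.
by rewrite !dot_lin dot_omull !mulr0.
Qed.

Let log_radiusE : log_radius (cone_coords p) = lift_angle p.
Proof.
by rewrite /log_radius cxyE.1 !dot_lin uu mulr1 -expRD expRK; lra.
Qed.

Let cos_sinE : cos (atan (sin_part p / cos_part p)) = cos_part p /\
  sin (atan (sin_part p / cos_part p)) = sin_part p.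
Proof.
apply: cos_sin_atan; first by case: pO.
move: ee; rewrite dot2E /sin_part /cos_part => e1.
transitivity ((p.1.1 0 0 * p.1.1 0 0 + p.1.1 0 1 * p.1.1 0 1) * (cos al ^+ 2 + sin al ^+ 2)).
  by ring.
by rewrite cos2Dsin2 mulr1 e1.
Qed.

Lemma cone_coords_point_dom : cone_point_dom (cone_coords p).
Proof.
have a1 := atan_gtNpi2 (sin_part p / cos_part p).
have a2 := atan_ltpi2 (sin_part p / cos_part p).
split; [split; [split|]|]; rewrite /= ?log_radiusE ?cxyE.1.
- exact: cone_dom_coords.
- by rewrite !dot_lin uu mulr1 mulr_gt0// expR_gt0.
- by rewrite /lift_angle; lra.
- by rewrite /lift_angle; lra.
Qed.

Lemma cone_coordsK : cone_point (cone_coords p) = p.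
Proof.
have [c s] := cos_sinE.
have rr (n : nat) (m : 'rV[R]_n) : expR (- lift_angle p) *: (r *: m) = m.
  by rewrite scalerA -expRD addNr expR0 scale1r.
rewrite /cone_point log_radiusE cxyE.1 cxyE.2 !rr ocoordK uu scale1r.
rewrite [in RHS](surjective_pairing p) [in RHS](surjective_pairing p.1).
congr (_, _, _); apply: row2P; rewrite !mxE /= /lift_angle ?cosD ?sinD c s.
  transitivity (p.1.1 0 0 * (cos al ^+ 2 + sin al ^+ 2)); last by rewrite cos2Dsin2 mulr1.
  by rewrite /cos_part /sin_part; ring.
transitivity (p.1.1 0 1 * (cos al ^+ 2 + sin al ^+ 2)); last by rewrite cos2Dsin2 mulr1.
by rewrite /cos_part /sin_part; ring.
Qed.

End Coords.

End Chart.

(** * The almost complex structure in the charts *)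

Section Induced.
Variables (R : realType).
Local Notation V := ('rV[R]_2 * 'rV[R]_8 * 'rV[R]_7)%type.
Local Notation X := ('rV[R]_7 * 'rV[R]_7)%type.

(** Rewrites [octJ] in terms of v instead of w, with tangent vectors given by the derivatives l, u',
    v' of t, u, v. In these variables it is the formula for multiplication by i. *)
Lemma J_cone (e : 'rV[R]_2) (u v u' v' u2 v2 : 'rV[R]_8) (l l2 : R) :
  dot e e = 1 -> dot u u = 1 -> dot v u = 0 -> dot u u' = 0 ->
  dot v u' + dot v' u = 0 -> l2 = dot v u' ->
  u2 = - (l *: v) - v' - l2 *: u -> v2 = l *: u + u' - l2 *: v ->
  octJ (e, u, ocoord u v) (l *: rot e, u', ocoord u' v + ocoord u v') =
  (l2 *: rot e, u2, ocoord u2 v + ocoord u v2).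
Proof.
move=> ee uu vu uu' vu' l2E u2E v2E.
set p := (e, u, _); set t := (_, u', _).
have vE : omul p.1.2 p.2 = v by rewrite /= omulK uu vu scale1r scale0r subr0.
have v'E : vdiff p t = v'.
  rewrite /vdiff /= omulDr addrA omulK uu scale1r.
  have := omulK_polar u' u v; rewrite (dotC u') uu' mulr0 scale0r vu scale0r subr0 sub0r => ->.
  have -> : dot v u' = - dot v' u by apply/eqP; rewrite -addr_eq0 vu'.
  by rewrite scaleNr opprK addrCA subrr addr0.
have aE : angle_diff p t = l by rewrite /angle_diff /= dotZr dot_rot ee mulr1.
have jE : Jangle p t = l2 by rewrite /Jangle vE.
have uE : Ju p t = u2 by rewrite /Ju vE v'E aE jE.
have v2E' : Jv p t = v2 by rewrite /Jv vE aE jE.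
by rewrite /octJ uE v2E' jE vE addrC.
Qed.

(** Passage from the unit vectors to x + i y = e^t (u + i v), with E = e^(-t): the terms in - l come
    from differentiating E, and the equations for [x2] and [y2] are Cauchy-Riemann. *)
Lemma J_cone_scaled (e : 'rV[R]_2) (x y x' y' x2 y2 : 'rV[R]_8) (E l l2 : R) :
  dot e e = 1 -> E * E * dot x x = 1 -> dot y x = 0 -> dot y x' + dot y' x = 0 ->
  l = E * E * dot x x' -> l2 = E * E * dot x x2 -> x2 = - y' -> y2 = x' ->
  let u' := - l *: (E *: x) + E *: x' in
  let v' := - l *: (E *: y) + E *: y' in
  let u2 := - l2 *: (E *: x) + E *: x2 in
  let v2 := - l2 *: (E *: y) + E *: y2 in
  octJ (e, E *: x, ocoord (E *: x) (E *: y))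
    (l *: rot e, u', ocoord u' (E *: y) + ocoord (E *: x) v') =
  (l2 *: rot e, u2, ocoord u2 (E *: y) + ocoord (E *: x) v2).
Proof.
move=> ee xx yx yx' lE l2E x2E y2E u' v' u2 v2.
have y'x : dot y x' = - dot y' x by apply/eqP; rewrite -addr_eq0 yx'.
apply: J_cone => //.
- by rewrite !dot_lin mulrA.
- by rewrite !dot_lin yx !mulr0.
- rewrite /u' !dot_lin; transitivity (- l * (E * E * dot x x) + E * E * dot x x'); first by ring.
  by rewrite xx -lE mulr1 addNr.
- rewrite /u' /v' !dot_lin yx.
  by transitivity (E * E * (dot y x' + dot y' x)); [ring|rewrite yx' mulr0].
- by rewrite l2E x2E /u' !dot_lin yx y'x (dotC x); ring.
- by rewrite /u2 x2E; apply/rowP => j; rewrite !mxE; ring.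
by rewrite /v2 y2E; apply/rowP => j; rewrite !mxE; ring.
Qed.

Variables (eps : R) (k : 'I_7).
Hypothesis eps2 : eps * eps = 1.
Local Notation cx := (cone_x eps k).
Local Notation cy := (cone_y eps k).

Section Point.
Variables (al : R) (z : X).
Hypothesis zU : cone_point_dom al eps k z.
Local Notation L := (log_radius eps k z).
Local Notation E := (expR (- L)).
Local Notation u := (E *: cx z).
Local Notation v := (E *: cy z).

Let zD : cone_dom z. Proof. by case: zU => -[[]]. Qed.
Let N0 : 0 < dot (cx z) (cx z). Proof. by case: zU => -[[_]]. Qed.
Let EN : E * E * dot (cx z) (cx z) = 1. Proof. exact: exp_log_radius zU. Qed.

Let dx : differentiable cx z.
Proof.
by case: (smooth_cone eps k) => oD sx _ _; exact: smooth_differentiable (row_smoothP oD sx) zD.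
Qed.

Let dy : differentiable cy z.
Proof.
by case: (smooth_cone eps k) => oD _ sy _; exact: smooth_differentiable (row_smoothP oD sy) zD.
Qed.

Let dxx s : differentiable (fun z => dot (cx z) (cx z)) z /\
  'd (fun z => dot (cx z) (cx z)) z s = 2 * dot (cx z) ('d cx z s).
Proof.
split; last first.
  by apply: (etrans (diff_dot s dx dx)); rewrite (dotC ('d cx z s)); ring.
case: (smooth_cone eps k) => oD sx _ _.
exact: smooth_differentiable (smooth_dot oD sx sx) zD.
Qed.

Let dL s : differentiable (log_radius eps k) z /\
  'd (log_radius eps k) z s = E * E * dot (cx z) ('d cx z s).
Proof.
have [d1 d1E] := dxx s.
have [d2 d2E] := is_derive_differentiable (is_derive1_ln N0).
have dln : differentiable (fun z => ln (dot (cx z) (cx z))) z by exact: differentiable_comp d1 d2.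
split; first exact: differentiableZl.
apply: (etrans (diffZlE _ _ dln)).
have -> : 'd (fun z => ln (dot (cx z) (cx z))) z s =
    2 * dot (cx z) ('d cx z s) * (1 * (dot (cx z) (cx z))^-1).
  by apply: (etrans (diff_comp1 s d1 d2)); congr (_ * _).
have -> : (dot (cx z) (cx z))^-1 = E * E.
  by rewrite -[RHS](mulfK (lt0r_neq0 N0)) EN mul1r.
by rewrite -[_ *: _]/(_ * _); lra.
Qed.

Let dE s : differentiable (fun z => expR (- log_radius eps k z)) z /\
  'd (fun z => expR (- log_radius eps k z)) z s = - 'd (log_radius eps k) z s * E.
Proof.
have [d1 _] := dL s; have d2 := differentiableN d1.
have [d3 d3E] := is_derive_differentiable (is_derive_expR (- L)).
split; first exact: differentiable_comp d2 d3.
apply: (etrans (diff_comp1 s d2 d3)); rewrite d3E mul1r.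
by congr (_ * _); exact: diffNE.
Qed.

Let doms := smooth_cone_point al eps k.

Let dcirc s : differentiable (fun z => circle (log_radius eps k z)) z /\
  'd (fun z => circle (log_radius eps k z)) z s = 'd (log_radius eps k) z s *: rot (circle L).
Proof.
have [_ sp _] := doms.
have [d1 _] := dL s.
have dp := smooth_differentiable sp zU.
have dc : differentiable (fun z => circle (log_radius eps k z)) z.
  exact: (diff_linear_comp s (continuous_linear_circle R) dp).1.
split=> //.
have C j := (@diff_linear_comp _ _ _ _ _ _ z s (continuous_linear_coord R j) dc).2.
have [e1 e2] := rotE (circle L).
apply: row2P.
  rewrite -C mxE e1.
  have -> : (fun z => circle (log_radius eps k z) 0 0) = (fun z => cos (log_radius eps k z)).
    by apply/funext => y; rewrite mxE.
  have [d2 d2E] := is_derive_differentiable (is_derive_cos L).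
  by apply: (etrans (diff_comp1 s d1 d2)); rewrite d2E mul1r mxE.
rewrite -C mxE e2.
have -> : (fun z => circle (log_radius eps k z) 0 1) = (fun z => sin (log_radius eps k z)).
  by apply/funext => y; rewrite mxE.
have [d2 d2E] := is_derive_differentiable (is_derive_sin L).
by apply: (etrans (diff_comp1 s d1 d2)); rewrite d2E mul1r mxE.
Qed.

Let du s : differentiable (fun z => expR (- log_radius eps k z) *: cx z) z /\
  'd (fun z => expR (- log_radius eps k z) *: cx z) z s =
  - 'd (log_radius eps k) z s *: u + E *: 'd cx z s.
Proof.
have [_ sp _] := doms; have dp := smooth_differentiable sp zU.
have d1 : differentiable (fun z => expR (- log_radius eps k z) *: cx z) z.
  exact: (diff_linear_comp s (continuous_linear_sphere7 R) dp).1.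
split=> //; have [d2 d2E] := dE s.
by apply: (etrans (diff_rowZ s d2 dx d1)); rewrite scalerA; congr (_ *: _ + _).
Qed.

Let dv s : differentiable (fun z => expR (- log_radius eps k z) *: cy z) z /\
  'd (fun z => expR (- log_radius eps k z) *: cy z) z s =
  - 'd (log_radius eps k) z s *: v + E *: 'd cy z s.
Proof.
have [_ _ sv] := doms; have d1 := smooth_differentiable sv zU; have [d2 d2E] := dE s.
split=> //.
by apply: (etrans (diff_rowZ s d2 dy d1)); rewrite scalerA; congr (_ *: _ + _).
Qed.

Lemma diff_cone_point s : 'd (cone_point eps k) z s =
  (let l := 'd (log_radius eps k) z s in
   let u' := - l *: u + E *: 'd cx z s in
   let v' := - l *: v + E *: 'd cy z s in
   (l *: rot (circle L), u', ocoord u' v + ocoord u v')).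
Proof.
have [_ sp _] := doms; have dp := smooth_differentiable sp zU.
have [d1 d1E] := dcirc s; have [d2 d2E] := du s; have [d3 d3E] := dv s.
have d4 : differentiable (fun z => ocoord (expR (- log_radius eps k z) *: cx z)
    (expR (- log_radius eps k z) *: cy z)) z.
  exact: (diff_linear_comp s (continuous_linear_sphere6 R) dp).1.
have d5 := differentiable_pair d1 d2.
have E1 := etrans (f_equal (fun h : X -> _ => h s) (diff_pair d1 d2)) (f_equal2 pair d1E d2E).
have E2 := etrans (diff_ocoord s d2 d3 d4)
  (f_equal2 +%R (f_equal (fun a => ocoord a v) d2E) (f_equal (ocoord u) d3E)).
exact (etrans (f_equal (fun h : X -> V => h s) (diff_pair d5 d4)) (f_equal2 pair E1 E2)).
Qed.

Lemma J_cone_point t :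
  octJ (cone_point eps k z) ('d (cone_point eps k) z t) =
  'd (cone_point eps k) z (realify_i t).
Proof.
have [h1 h2] := diff_cone eps k zD t.
have [_ l1] := dL t; have [_ l2] := dL (realify_i t).
have vx : dot (cy z) ('d cx z t) + dot ('d cy z t) (cx z) = 0.
  apply: (etrans (esym (diff_dot t dy dx))).
  have [oD _ _ _] := smooth_cone eps k.
  have n0 : \forall y \near z, cst 0 y = dot (cy y) (cx y).
    by apply: filterS (open_nbhs_nbhs (conj oD zD)) => y yD; rewrite (cone_eq k eps2 yD).2.
  by apply: etrans (near_eq_diffE _ n0 (differentiable_cst _ _)) _; exact: diff_cstE.
have ee : dot (circle L) (circle L) = 1 by rewrite dot2E !mxE /= -!expr2 cos2Dsin2.
have JE := J_cone_scaled ee EN (cone_eq k eps2 zD).2 vx l1 l2 h1 h2.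
exact (etrans (f_equal (octJ (cone_point eps k z)) (diff_cone_point t))
  (etrans JE (esym (diff_cone_point (realify_i t))))).
Qed.

End Point.
End Induced.

(** * The atlas and the integrability of the structure *)

Section Main.
Variable R : realType.
Local Notation V := ('rV[R]_2 * 'rV[R]_8 * 'rV[R]_7)%type.
Implicit Types (al eps : R) (k : 'I_7) (p : V).

Definition cone_chart al eps k : complex_chart V 7 :=
  ComplexChart (@sphere_prod R `&` cone_coords_dom al eps k)
    (@complexify R 7 \o cone_coords al eps k) (cone_point eps k \o @realify R 7).

Lemma cone_chart_imageE al eps k : eps * eps = 1 ->
  chart_image (cone_chart al eps k) = @realify R 7 @^-1` cone_point_dom al eps k.
Proof.
move=> eps2; apply/seteqP; split=> [_ [p [Mp pO] <-]|w wU] /=.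
  by rewrite complexifyK; exact: cone_coords_point_dom.
exists (cone_point eps k (realify w)).
  by split; [exact: cone_point_M wU|exact: cone_point_coords_dom].
by rewrite /= cone_pointK// realifyK.
Qed.

Lemma cone_chart_invE al eps k :
  chart_inv (cone_chart al eps k) \o @complexify R 7 = cone_point eps k.
Proof. by apply/funext => z /=; rewrite complexifyK. Qed.

Lemma smooth_cone_chart al eps k : eps * eps = 1 ->
  smooth_chart (@sphere_prod R) (cone_chart al eps k).
Proof.
move=> eps2; have [oU sU] := smooth_cone_coords al eps k.
have [oW sW _] := smooth_cone_point al eps k.
split.
- by exists (cone_coords_dom al eps k).
- rewrite cone_chart_imageE//; apply: open_comp => // z _; exact: realify_continuous.
- by move=> p [Mp pO] /=; rewrite complexifyK cone_coordsK.
- have -> : @realify R 7 \o chart_map (cone_chart al eps k) = cone_coords al eps k.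
    by apply/funext => p /=; rewrite complexifyK.
  by apply: smooth_on_smooth oU _ sU => p [].
rewrite cone_chart_invE; apply: smooth_on_smooth oW _ sW => _ [w + <-].
by rewrite cone_chart_imageE.
Qed.

Lemma induced_cone_chart al eps k : eps * eps = 1 ->
  induced_by_chart (@octJ R) (cone_chart al eps k).
Proof.
move=> eps2 w xi; rewrite cone_chart_imageE// => wU.
rewrite cone_chart_invE /= realifyZi; exact: J_cone_point wU _.
Qed.

(** The open half circles centred at the angles 0, pi, pi / 2 and - pi / 2 cover the circle. *)
Lemma exists_cos_part p : sphere_prod p -> exists al, 0 < cos_part al p.
Proof.
move=> [[/sphereE]]; rewrite dot2E /cos_part => + _ _.
set c := p.1.1 0 0; set s := p.1.1 0 1 => cs.
have [c0|c0|c0] := ltgtP 0 c.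
- by exists 0; rewrite cos0 sin0 mulr0 addr0 mulr1.
- by exists pi; rewrite cospi sinpi mulr0 addr0 mulrN1 oppr_gt0.
have [s0|s0|s0] := ltgtP 0 s.
- by exists (pi / 2); rewrite cos_pihalf sin_pihalf mulr0 add0r mulr1.
- by exists (- (pi / 2)); rewrite cosN sinN cos_pihalf sin_pihalf mulr0 add0r mulrN1 oppr_gt0.
by move: cs; rewrite -c0 -s0 !mul0r addr0 => /esym/eqP; rewrite oner_eq0.
Qed.

(** Both signs are used: if a vanished for eps = 1 and eps = -1 and every k, adding and subtracting
    the equations would make all coordinates of u zero, against u being a unit vector. *)
Lemma exists_cone_a2 p : sphere_prod p -> exists (eps : R) (k : 'I_7),
  eps * eps = 1 /\ 0 < cone_a2 (unit_coords eps k p).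
Proof.
move=> [[_ /sphereE uu] _]; apply: contrapT => nex.
pose u := p.1.2; pose v := omul u p.2.
have H (eps : R) (k : 'I_7) : eps * eps = 1 ->
    u 0 0 - eps * v 0 (lift 0 k) = 0 /\ v 0 0 + eps * u 0 (lift 0 k) = 0.
  move=> eps2; have [e1 e2 _] := cone_projE eps k u v.
  have : ~~ (0 < cone_a2 (unit_coords eps k p)).
    by apply/negP => a2; apply: nex; exists eps, k.
  rewrite /cone_a2 /unit_coords e1 e2 -!expr2 lt_neqAle addr_ge0 ?sqr_ge0// andbT negbK eq_sym.
  by rewrite paddr_eq0 ?sqr_ge0// !sqrf_eq0 => /andP[/eqP -> /eqP ->].
have N1 : -1 * -1 = 1 :> R by rewrite mulrNN mulr1.
have u0 : u 0 0 = 0.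
  by have [+ _] := H 1 ord0 (mulr1 1); have [+ _] := H (-1) ord0 N1; lra.
have uk k : u 0 (lift 0 k) = 0.
  by have [_ +] := H 1 k (mulr1 1); have [_ +] := H (-1) k N1; lra.
move: uu; have -> : p.1.2 = 0.
  by apply/rowP => j; rewrite !mxE; case: (unliftP 0 j) => [k ->|->].
rewrite /dot big1 => [/esym/eqP|i _]; first by rewrite oner_eq0.
by rewrite mxE mul0r.
Qed.

Definition cone_atlas : set (complex_chart V 7) :=
  [set c | exists al eps k, eps * eps = 1 /\ c = cone_chart al eps k].

Lemma integrable_J : integrable_structure 7 (@sphere_prod R) (@octJ R).
Proof.
exists cone_atlas; last by move=> _ [al [eps [k [eps2 ->]]]]; exact: induced_cone_chart.
split.
- by move=> _ [al [eps [k [eps2 ->]]]]; exact: smooth_cone_chart.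
- apply/seteqP; split=> [p [_ [al [eps [k [_ ->]]]] []]//|p Mp].
  have [al c0] := exists_cos_part Mp; have [eps [k [eps2 a0]]] := exists_cone_a2 Mp.
  by exists (cone_chart al eps k); [exists al, eps, k|].
move=> _ _ [al [eps [k [eps2 ->]]]] [al' [eps' [k' [eps2' ->]]]].
apply: (@holomorphic_transition_of_induced _ _ _ (@sphere_prod R) (@octJ R)).
- exact: smooth_cone_chart.
- exact: smooth_cone_chart.
- exact: induced_cone_chart.
- exact: induced_cone_chart.
Qed.

End Main.

Theorem corollary1 (R : realType) :
  let M := sphere R 1 `*` sphere R 7 `*` sphere R 6 in
  exists J, almost_complex_structure M J /\ integrable_structure 7 M J.
Proof. by exists (@octJ R); split; [exact: almost_complex_J|exact: integrable_J]. Qed.
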